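(* The complex algebra $\mathcal E'(\mathbb R)$ of compactly supported distributions on $\mathbb R$, with convolution as multiplication, is not a GKŻ algebra over $\mathbb C$.
   Context: $\mathcal E'(\mathbb R)$ is the space of all distributions on $\mathbb R$ with compact support; under convolution it is a commutative unital complex algebra with unity the Dirac distribution $\delta_0$. A unital algebra $A$ over a field $\mathbb F$ is a GKŻ algebra if every linear functional $\Lambda:A\to\mathbb F$ such that $\Lambda(u)\neq0$ for all units $u$ of $A$ and $\Lambda(\mathbf 1_A)=1$ is multiplicative, i.e. $\Lambda(ab)=\Lambda(a)\Lambda(b)$ for all $a,b\in A$. *)

(* Defs.v *)
From HB Require Import structures.
From mathcomp Require Import all_boot all_order all_algebra.
From mathcomp Require Import all_classical all_reals all_analysis.
From mathcomp Require Import finmap complex ring lra.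
Set Implicit Arguments.
Unset Strict Implicit.
Unset Printing Implicit Defensive.
Import Order.TTheory GRing.Theory Num.Theory.
Import numFieldNormedType.Exports.
Local Open Scope ring_scope.
Local Open Scope classical_set_scope.

Section RealSmooth.
Variable R : realType.
Implicit Types (f g : R -> R) (x : R).

Definition smooth f := forall (n : nat) (x : R), derivable f^`(n) x 1.

Fixpoint Cn (n : nat) f : Prop :=
  if n is n'.+1 then exists2 g, (forall x, is_derive x 1 f (g x)) & Cn n' g
  else True.

Lemma is_derive_derive1 f g : (forall x, is_derive x 1 f (g x)) -> f^`() = g.
Proof. by move=> h; apply/funext => x; rewrite derive1E; apply: derive_val. Qed.

Lemma derivable_is_derive f x : derivable f x 1 -> is_derive x 1 f (f^`() x).
Proof. by move=> h; rewrite derive1E; apply/derivableP. Qed.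

Lemma smoothP f : smooth f <-> forall n, Cn n f.
Proof.
split.
  move=> + n; elim: n f => //= n IH f sf.
  exists f^`(); first by move=> x; apply: derivable_is_derive; exact: (sf 0%N).
  by apply: IH => k x; rewrite -derive1Sn.
move=> h n; move/(_ n.+1) : h; elim: n f => [|n IH] f [g fg cg] x.
  by rewrite derive1n0; case: (fg x).
by rewrite derive1Sn (is_derive_derive1 fg); apply: IH.
Qed.

Lemma smooth_derive1 f : smooth f -> smooth f^`().
Proof. by move=> sf n x; rewrite -derive1Sn. Qed.

Lemma smooth_is_derive f : smooth f -> forall x, is_derive x 1 f (f^`() x).
Proof. by move=> sf x; apply: derivable_is_derive; exact: (sf 0%N). Qed.

Lemma smooth_is_deriven f n : smooth f ->
  forall x, is_derive x 1 f^`(n) (f^`(n.+1) x).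
Proof. by move=> sf x; rewrite derive1nS; apply: derivable_is_derive. Qed.

Lemma CnW n f : Cn n.+1 f -> Cn n f.
Proof.
elim: n f => //= n IH f [g fg cg]; exists g => //; exact: IH.
Qed.

Lemma CnD n f g : Cn n f -> Cn n g -> Cn n (f + g).
Proof.
elim: n f g => //= n IH f g [f' ff cf] [g' gg cg].
by exists (f' + g') => [x|]; [exact: is_deriveD | exact: IH].
Qed.

Lemma Cn_cst n (a : R) : Cn n (fun=> a).
Proof.
by elim: n a => //= n IH a; exists (fun=> 0) => // x; exact: is_derive_cst.
Qed.

Lemma CnM n f g : Cn n f -> Cn n g -> Cn n (f * g).
Proof.
elim: n f g => //= n IH f g [f' ff cf] [g' gg cg].
exists (f * g' + g * f') => [x|]; first exact: is_deriveM.
have cf0 : Cn n f by apply: CnW => /=; exists f'.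
have cg0 : Cn n g by apply: CnW => /=; exists g'.
by apply: CnD; apply: IH.
Qed.

Lemma Cn_comp n f g : Cn n f -> Cn n g -> Cn n (f \o g).
Proof.
elim: n f g => //= n IH f g [f' ff cf] [g' gg cg].
exists ((f' \o g) * g') => [x|]; first exact: is_derive1_comp.
have cg0 : Cn n g by apply: CnW => /=; exists g'.
by apply: CnM => //; apply: IH.
Qed.

Lemma CnV n f : (forall x, f x != 0) -> Cn n f -> Cn n (fun x => (f x)^-1).
Proof.
move=> f0; elim: n f f0 => //= n IH f f0 [f' ff cf].
exists ((fun=> -1) * (((fun x => (f x)^-1) * (fun x => (f x)^-1)) * f')) => [x|].
  rewrite (_ : (_ * _) x = - f x ^- 2 *: f' x); first exact: is_deriveV.
  by rewrite /GRing.mul/= /GRing.scale/= expr2 invfM mulN1r mulNr.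
have cf0 : Cn n f by apply: CnW => /=; exists f'.
have := IH f f0 cf0 => ci.
by apply: CnM; [exact: Cn_cst|]; apply: CnM => //; apply: CnM.
Qed.

Lemma Cn_id n : Cn n (@idfun R).
Proof.
case: n => //= n; exists (fun=> 1); last exact: Cn_cst.
by move=> x; exact: is_derive_id.
Qed.

Lemma smoothD f g : smooth f -> smooth g -> smooth (f + g).
Proof. by rewrite !smoothP => ? ? n; apply: CnD. Qed.
Lemma smoothM f g : smooth f -> smooth g -> smooth (f * g).
Proof. by rewrite !smoothP => ? ? n; apply: CnM. Qed.
Lemma smooth_cst (a : R) : smooth (fun=> a).
Proof. by rewrite !smoothP => n; apply: Cn_cst. Qed.
Lemma smooth_id : smooth (@idfun R).
Proof. by rewrite !smoothP => n; apply: Cn_id. Qed.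
Lemma smooth_comp f g : smooth f -> smooth g -> smooth (f \o g).
Proof. by rewrite !smoothP => ? ? n; apply: Cn_comp. Qed.
Lemma smoothV f : (forall x, f x != 0) -> smooth f -> smooth (fun x => (f x)^-1).
Proof. by move=> f0; rewrite !smoothP => ? n; apply: CnV. Qed.

(* the functions x^-k exp(-1/x), extended by 0 to x <= 0 *)
Definition flat (k : nat) (x : R) : R :=
  if 0 < x then x ^- k * expR (- x^-1) else 0.

Lemma flat_ge0 k x : 0 <= flat k x.
Proof.
rewrite /flat; case: ifP => // x0.
by rewrite mulr_ge0 ?expR_ge0// invr_ge0 exprn_ge0// ltW.
Qed.

Lemma flat_gt0 k x : 0 < x -> 0 < flat k x.
Proof. by move=> x0; rewrite /flat x0 mulr_gt0 ?expR_gt0// invr_gt0 exprn_gt0. Qed.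

Lemma flat_le0 k x : x <= 0 -> flat k x = 0.
Proof. by rewrite /flat; case: ltP. Qed.

Lemma flat_bound k x : flat k x <= (k.+1)`!%:R * `|x|.
Proof.
rewrite /flat; case: ifPn => [x0|]; last by rewrite mulr_ge0.
have xv0 : 0 < x^-1 by rewrite invr_gt0.
rewrite gtr0_norm// expRN ler_pdivrMr ?expR_gt0//.
have f0 : 0 < (k.+1)`!%:R :> R by rewrite ltr0n fact_gt0.
rewrite -mulrA -ler_pdivrMl//.
apply: (@le_trans _ _ (x * (1 + x^-1 ^+ k.+1 / (k.+1)`!%:R))); last first.
  by rewrite ler_pM2l//; apply: expR_ge1Dxn; exact: ltW.
rewrite mulrDr mulr1 exprS !mulrA divff ?gt_eqF// mul1r exprVn mulrC lerDr.
exact: ltW.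
Qed.

Lemma is_derive_flat k x :
  is_derive x 1 (flat k) (flat k.+2 x - k%:R * flat k.+1 x).
Proof.
have [x0|x0|->] := ltgtP x 0.
- apply: (@near_eq_is_derive _ _ _ (cst 0)).
    by near=> y; rewrite flat_le0// ltW//; near: y; exact: lt_nbhsl.
  rewrite !flat_le0 ?ltW// mulr0 subr0; exact: is_derive_cst.
- apply: (@near_eq_is_derive _ _ _ (fun y : R => y^-1 ^+ k * expR (- y^-1) : R)).
    by near=> y; rewrite /flat ifT ?exprVn//; near: y; exact: lt_nbhsr.
  have dV : is_derive x 1 (fun y : R => y^-1) (- x ^- 2).
    have := @is_deriveV R id x 1 1 (lt0r_neq0 x0) (is_derive_id _ _).
    by rewrite /GRing.scale/= mulr1.
  have dX : is_derive x 1 (fun y : R => y^-1 ^+ k)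
     (k%:R * x^-1 ^+ k.-1 * (- x ^- 2)).
    have -> : (fun y : R => y^-1 ^+ k) = (fun y : R => y^-1) ^+ k.
      by apply/funext => y; rewrite exprfctE.
    apply: is_derive_eq; by rewrite /GRing.scale/= mulr_natl.
  have dE : is_derive x 1 (fun y : R => expR (- y^-1)) (expR (- x^-1) * x ^- 2).
    have dN : is_derive x 1 (fun y : R => - y^-1) (x ^- 2).
      by have := is_deriveN dV; rewrite opprK.
    exact: (@is_derive1_comp _ expR (fun y => - y^-1) _ _ _ (is_derive_expR _) dN).
  have dM : is_derive x 1 (fun y : R => y^-1 ^+ k * expR (- y^-1) : R) _ :=
    is_deriveM dX dE.
  apply: (is_derive_eq dM).
  rewrite /flat x0 /GRing.scale/=.
  have xn0 : x != 0 by rewrite gt_eqF.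
  rewrite -!exprVn !exprS; case: k {dX dM} => [|k] /=.
    by rewrite !expr0 mul0r !mul0r mulr0 addr0 subr0 !mul1r mulr1 mulrC.
  rewrite exprS; ring.
- have -> : flat k.+2 0 - k%:R * flat k.+1 0 = 0 :> R.
    by rewrite !flat_le0// mulr0 subr0.
  have d0 : h^-1 *: (flat k (h *: 1 + 0) - flat k 0) @[h --> (0:R)^'] --> (0:R).
    apply: (@squeeze_cvgr _ _ _ _ (fun h => - ((k.+2)`!%:R * `|h|))
                                  (fun h => (k.+2)`!%:R * `|h|)).
    + near=> h.
      rewrite (flat_le0 _ (lexx 0)) subr0 addr0 /GRing.scale/= mulr1.
      have <- : flat k.+1 h = h^-1 * flat k h.
        rewrite /flat; case: ifP => _; last by rewrite mulr0.
        by rewrite mulrA exprS invfM.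
      rewrite flat_bound andbT.
      by rewrite (le_trans _ (flat_ge0 _ _))// oppr_le0 mulr_ge0// ler0n.
    + rewrite -[X in _ --> X]oppr0; apply: cvgN.
      rewrite -[X in _ --> X](mulr0 (k.+2)`!%:R); apply: cvgMr.
      by rewrite -[X in _ --> X](@normr0 _ R); apply: cvg_norm; exact: nbhs_dnbhs.
    + rewrite -[X in _ --> X](mulr0 (k.+2)`!%:R); apply: cvgMr.
      by rewrite -[X in _ --> X](@normr0 _ R); apply: cvg_norm; exact: nbhs_dnbhs.
  have e0 : derivable (flat k) 0 1 by apply/cvg_ex; exists 0.
  apply: DeriveDef => //; exact: cvg_lim d0.
Unshelve. all: by end_near. Qed.

Lemma smooth_flat k : smooth (flat k).
Proof.
apply/smoothP => n; elim: n k => //= n IH k.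
exists (flat k.+2 + (fun=> - k%:R) * flat k.+1).
  move=> x; rewrite /GRing.add/= /GRing.mul/= mulNr; exact: is_derive_flat.
by apply: CnD => //; apply: CnM => //; exact: Cn_cst.
Qed.

(* smooth, 0 on x <= 0 and 1 on x >= 1 *)
Definition step (x : R) : R := flat 0 x / (flat 0 x + flat 0 (1 - x)).

Lemma step_den x : flat 0 x + flat 0 (1 - x) != 0.
Proof.
have [x0|x0] := ltP 0 x.
  by rewrite gt_eqF// ltr_wpDr ?flat_ge0 ?flat_gt0.
rewrite gt_eqF// ltr_wpDl ?flat_ge0 ?flat_gt0//; lra.
Qed.

Lemma smooth_step : smooth step.
Proof.
have h : smooth (fun x : R => flat 0 x + flat 0 (1 - x)).
  have -> : (fun x : R => flat 0 x + flat 0 (1 - x)) =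
    flat 0 + (flat 0 \o ((fun=> 1) + (fun=> -1) * idfun)).
    by apply/funext => x; rewrite !fctE/= mulN1r.
  apply: smoothD; first exact: smooth_flat.
  apply: smooth_comp; first exact: smooth_flat.
  apply: smoothD; first exact: smooth_cst.
  by apply: smoothM; [exact: smooth_cst|exact: smooth_id].
apply: smoothM; first exact: smooth_flat.
exact: (smoothV step_den h).
Qed.

Lemma step_le0 x : x <= 0 -> step x = 0.
Proof. by move=> x0; rewrite /step flat_le0// mul0r. Qed.

Lemma step_ge1 x : 1 <= x -> step x = 1.
Proof.
move=> x1; have := step_den x; rewrite /step (@flat_le0 0 (1 - x)) ?addr0; last by lra.
exact: divff.
Qed.

(* smooth cutoff: 1 on [c - r/2, c + r/2], 0 where |x - c| >= r *)
Definition plateau (c r x : R) : R := step (2 - 2 * ((x - c) / r) ^+ 2).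

Lemma smooth_plateau c r : smooth (plateau c r).
Proof.
have -> : plateau c r = step \o ((fun=> 2) + (fun=> -2) *
   ((idfun + (fun=> -c)) * (fun=> r^-1) * ((idfun + (fun=> -c)) * (fun=> r^-1)))).
  by apply/funext => x; rewrite /plateau !fctE/= mulNr expr2.
have sa : smooth ((idfun + (fun=> -c)) * (fun=> r^-1)).
  by apply: smoothM; [apply: smoothD|]; [exact: smooth_id|exact: smooth_cst..].
apply: smooth_comp; first exact: smooth_step.
apply: smoothD; first exact: smooth_cst.
apply: smoothM; first exact: smooth_cst.
exact: smoothM.
Qed.

Lemma plateau1 c r x : 0 < r -> `|x - c| <= r / 2 -> plateau c r x = 1.
Proof.
move=> r0 h; apply: step_ge1.
have : ((x - c) / r) ^+ 2 <= 2^-1 ^+ 2.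
  rewrite -[leLHS]real_normK ?num_real// lerXn2r ?nnegrE ?normr_ge0 ?invr_ge0//.
  by rewrite normrM normfV (gtr0_norm r0) ler_pdivrMr// mulrC.
have -> : 2^-1 ^+ 2 = 4^-1 :> R by rewrite exprVn -natrX.
lra.
Qed.

Lemma plateau0 c r x : 0 < r -> r <= `|x - c| -> plateau c r x = 0.
Proof.
move=> r0 h; apply: step_le0.
have : 1 <= ((x - c) / r) ^+ 2.
  rewrite -[leRHS]real_normK ?num_real// -[leLHS](expr1n _ 2).
  rewrite lerXn2r ?nnegrE ?normr_ge0//.
  by rewrite normrM normfV (gtr0_norm r0) ler_pdivlMr// mul1r.
lra.
Qed.

End RealSmooth.

Section RealSmoothMore.
Variable R : realType.
Implicit Types (f g : R -> R) (x : R).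

Lemma derive1nD f g n : smooth f -> smooth g ->
  derive1n n (f + g) = derive1n n f + derive1n n g.
Proof.
move=> sf sg; elim: n => // n IH; rewrite !derive1nS IH.
apply: is_derive_derive1 => x; rewrite -!derive1nS.
by apply: is_deriveD; exact: smooth_is_deriven.
Qed.

Lemma derive1nZ (a : R) f n : smooth f ->
  derive1n n ((fun=> a) * f) = (fun=> a) * derive1n n f.
Proof.
move=> sf; elim: n => // n IH; rewrite !derive1nS IH.
apply: is_derive_derive1 => x; rewrite -!derive1nS.
have := is_deriveM (is_derive_cst a x 1) (smooth_is_deriven n sf x).
by rewrite /GRing.scale/= mulr0 addr0.
Qed.

Lemma smooth_shift (a : R) f : smooth f -> smooth (fun x => f (a + x)).
Proof.
move=> sf; have -> : (fun x => f (a + x)) = f \o ((fun=> a) + idfun).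
  by apply/funext.
by apply: smooth_comp => //; apply: smoothD; [exact: smooth_cst|exact: smooth_id].
Qed.

Lemma derive1n_shift (a : R) f n : smooth f ->
  (fun x => f (a + x))^`(n) = fun x => f^`(n) (a + x).
Proof.
move=> sf; elim: n => // n IH; rewrite derive1nS IH.
apply: is_derive_derive1 => x.
have d1 : is_derive x 1 (fun x => a + x) 1.
  have := is_deriveD (is_derive_cst a x 1) (is_derive_id x (1 : R)).
  by rewrite add0r.
have := @is_derive1_comp _ f^`(n) (fun x => a + x) x _ _
  (smooth_is_deriven n sf (a + x)) d1.
by rewrite mulr1.
Qed.

Lemma derive1n_supp f b n : (forall x, b < `|x| -> f x = 0) ->
  forall x, b < `|x| -> f^`(n) x = 0.
Proof.
move=> f0; elim: n => // n IH x bx.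
rewrite derive1nS derive1E.
rewrite (@near_eq_derive _ _ _ _ (cst 0)) ?derive_cst//.
have : open [set y : R | b < `|y|].
  by apply: (@open_comp _ _ (fun y : R => `|y|) [set z | b < z]);
    [move=> y _; exact: norm_continuous|exact: open_gt].
by move=> oU; near=> y; rewrite IH//; near: y; exact: (open_nbhs_nbhs (conj oU bx)).
Unshelve. all: by end_near. Qed.

Lemma smooth_continuous f : smooth f -> continuous f.
Proof.
move=> sf x; apply: differentiable_continuous; apply/derivable1_diffP.
exact: (sf 0%N).
Qed.

Lemma smooth_bounded f b : smooth f -> (forall x, b < `|x| -> f x = 0) ->
  exists B : R, forall x, `|f x| <= B.
Proof.
move=> sf f0; have cf := smooth_continuous sf.
have [b0|b0] := leP 0 b; last first.
  by exists 0 => x; rewrite f0 ?normr0// (lt_le_trans b0).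
have bb : - b <= b by lra.
have [||c _ hc] := @EVT_max R (fun x => `|f x|) (- b) b.
- exact: bb.
- apply: continuous_subspaceT => x; apply: continuous_comp; first exact: cf.
  exact: norm_continuous.
exists `|f c| => x; have [xb|xb] := leP `|x| b; last by rewrite f0 ?normr0.
by apply: hc; rewrite in_itv/= -ler_norml.
Qed.

Lemma mvt_ex f (a b : R) : smooth f ->
  exists2 c, `|c - a| <= `|b - a| & f b - f a = derive1 f c * (b - a).
Proof.
move=> sf; have df := smooth_is_derive sf.
have cf c d : {within `[c, d], continuous f}.
  by apply: continuous_subspaceT; exact: smooth_continuous.
have [ab|/ltW ba] := leP a b.
  have [c] := MVT_segment ab (fun x _ => df x) (cf _ _).
  rewrite in_itv/= => /andP[ac cb] e; exists c => //.
  by rewrite !ger0_norm ?subr_ge0// lerD2r.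
have [c] := MVT_segment ba (fun x _ => df x) (cf _ _).
rewrite in_itv/= => /andP[bc ca] e; exists c; last first.
  by rewrite -opprB e -mulrN opprB.
by rewrite distrC [leRHS]distrC !ger0_norm ?subr_ge0// lerD2l lerN2.
Qed.

Lemma taylor1 f (B y h : R) : smooth f -> (forall x, `|derive1n 2 f x| <= B) -> h != 0 ->
  `|h^-1 * (f (h + y) - f y) - derive1 f y| <= `|h| * B.
Proof.
move=> sf hB h0.
have [c hc ->] := mvt_ex y (h + y) sf.
have [d hd e] := mvt_ex y c (smooth_derive1 sf).
rewrite addrK in hc *; rewrite mulrC mulfK// e normrM mulrC.
rewrite ler_pM//; have := hB d; by rewrite derive1nS derive1n1.
Qed.

End RealSmoothMore.

Section TestFunctions.
Variable R : realType.
Local Notation C := R[i].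
Local Notation Re := (@complex.Re R).
Local Notation Im := (@complex.Im R).
Local Notation normc := (@Normc.normc R).

Definition csmooth (f : R -> C) := smooth (Re \o f) /\ smooth (Im \o f).

(* complex-valued functions of a real variable are differentiated componentwise *)
Definition cderive (n : nat) (f : R -> C) (x : R) : C :=
  ((Re \o f)^`(n) x +i* (Im \o f)^`(n) x)%C.

Definition fsupport (f : R -> C) : set R := closure [set x | f x != 0].

Definition test_function : {pred R -> C} :=
  mem [set f | csmooth f /\ compact (fsupport f)].

Lemma fsupport0 f x : ~ fsupport f x -> f x = 0.
Proof.
by move=> h; apply/eqP/negPn/negP => fx; apply: h; exact: subset_closure.
Qed.

Lemma compact_fsupportP f :
  compact (fsupport f) <-> exists b : R, forall x, b < `|x| -> f x = 0.
Proof.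
split=> [/compact_bounded [b [_ hb]]|[b f0]].
  exists (b + 1) => x bx; apply: fsupport0 => fx.
  have b1 : b < b + 1 by rewrite ltrDl.
  by have := hb (b + 1) b1 x fx; rewrite /= leNgt bx.
apply: (@subclosed_compact _ _ `[- b, b]).
- exact: closed_closure.
- exact: segment_compact.
- have : closed `[- b, b]%classic by exact: interval_closed.
  move=> /closure_id ->; apply: closure_subset => x /= fx.
  rewrite in_itv/= -ler_norml leNgt; apply/negP => bx.
  by move: fx; rewrite f0// eqxx.
Qed.

Lemma test_functionP f : reflect
  (csmooth f /\ exists b : R, forall x, b < `|x| -> f x = 0) (f \in test_function).
Proof.
apply: (iffP idP) => [/set_mem[sf /compact_fsupportP]|[sf cf]] //.
by apply/mem_set; split=> //; exact/compact_fsupportP.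
Qed.

Lemma csmoothD (f g : R -> C) : csmooth f -> csmooth g -> csmooth (f + g).
Proof.
move=> [f1 f2] [g1 g2]; split.
  have -> : Re \o (f + g) = (Re \o f) + (Re \o g).
    by apply/funext => x; rewrite !fctE/=; case: (f x) (g x) => ? ? [].
  exact: smoothD.
have -> : Im \o (f + g) = (Im \o f) + (Im \o g).
  by apply/funext => x; rewrite !fctE/=; case: (f x) (g x) => ? ? [].
exact: smoothD.
Qed.

Lemma csmoothM (f g : R -> C) : csmooth f -> csmooth g -> csmooth (f * g).
Proof.
move=> [f1 f2] [g1 g2]; split.
  have -> : Re \o (f * g) =
      (Re \o f) * (Re \o g) + (fun=> -1) * ((Im \o f) * (Im \o g)).
    by apply/funext => x; rewrite !fctE/= mulN1r; case: (f x) (g x) => ? ? [].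
  by apply: smoothD; [|apply: smoothM; first exact: smooth_cst]; exact: smoothM.
have -> : Im \o (f * g) = (Re \o f) * (Im \o g) + (Im \o f) * (Re \o g).
  by apply/funext => x; rewrite !fctE/=; case: (f x) (g x) => ? ? [].
by apply: smoothD; exact: smoothM.
Qed.

Lemma csmooth_cst (a : C) : csmooth (fun=> a).
Proof. by split; exact: smooth_cst. Qed.

Lemma test_function_submod : GRing.submod_closed test_function.
Proof.
split.
  by apply/test_functionP; split; [exact: csmooth_cst|exists 0].
move=> a f g /test_functionP[sf [b f0]] /test_functionP[sg [c g0]].
apply/test_functionP; split.
  by apply: csmoothD => //; apply: (csmoothM (csmooth_cst a)).
exists (Num.max b c) => x; rewrite gt_max => /andP[bx cx].
have -> : (a *: f + g) x = a * f x + g x by [].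
by rewrite f0// g0// mulr0 addr0.
Qed.

HB.instance Definition _ :=
  GRing.isSubmodClosed.Build C (R -> C) test_function test_function_submod.

(* the space D(R) of smooth complex-valued functions of compact support *)
Record testfun := TestFun {
  testfun_val :> R -> C ;
  testfunP : testfun_val \in test_function }.

HB.instance Definition _ := [isSub for testfun_val].
HB.instance Definition _ := [Choice of testfun by <:].
HB.instance Definition _ := [SubChoice_isSubLmodule of testfun by <:].

End TestFunctions.

Section TestFunctionTheory.
Variable R : realType.
Local Notation C := R[i].
Local Notation Re := (@complex.Re R).
Local Notation Im := (@complex.Im R).
Local Notation normc := (@Normc.normc R).
Implicit Types (phi psi : testfun R) (x y : R) (n k : nat).

Lemma ReD (z w : C) : Re (z + w) = Re z + Re w.
Proof. by case: z w => ? ? []. Qed.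

Lemma ImD (z w : C) : Im (z + w) = Im z + Im w.
Proof. by case: z w => ? ? []. Qed.

Lemma ReZ (a : R) (z : C) : Re (a%:C%C * z) = a * Re z.
Proof. by case: z => b c /=; rewrite mul0r subr0. Qed.

Lemma ImZ (a : R) (z : C) : Im (a%:C%C * z) = a * Im z.
Proof. by case: z => b c /=; rewrite mul0r addr0. Qed.

Lemma ReN (z : C) : Re (- z) = - Re z. Proof. by case: z. Qed.

Lemma ImN (z : C) : Im (- z) = - Im z. Proof. by case: z. Qed.

Lemma normc_ge0 (z : C) : 0 <= normc z.
Proof. by case: z => a b; exact: sqrtr_ge0. Qed.

Lemma normc_le_ReIm (z : C) : normc z <= `|Re z| + `|Im z|.
Proof.
case: z => a b /=.
rewrite -[leRHS](@ger0_norm _ (`|a| + `|b|)) ?addr_ge0// -sqrtr_sqr.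
rewrite ler_wsqrtr// sqrrD !real_normK ?num_real//.
have : 0 <= `|a| * `|b| by rewrite mulr_ge0.
lra.
Qed.

Lemma Re_le_normc (z : C) : `|Re z| <= normc z.
Proof.
by case: z => a b /=; rewrite -sqrtr_sqr ler_wsqrtr// lerDl sqr_ge0.
Qed.

Lemma Im_le_normc (z : C) : `|Im z| <= normc z.
Proof.
by case: z => a b /=; rewrite -sqrtr_sqr ler_wsqrtr// lerDr sqr_ge0.
Qed.

Lemma normcD (z w : C) : normc (z + w) <= normc z + normc w.
Proof. exact: le_normcD. Qed.

Lemma testfun_smooth phi : csmooth phi.
Proof. by case: phi => f /= /test_functionP[]. Qed.

Lemma testfun_supp phi : exists b : R, forall x, b < `|x| -> phi x = 0.
Proof. by case: phi => f /= /test_functionP[]. Qed.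

Lemma testfun_ext phi psi : phi =1 psi -> phi = psi.
Proof. by move=> h; apply: val_inj; apply/funext. Qed.

Lemma testfunDE phi psi x : (phi + psi) x = phi x + psi x.
Proof. by []. Qed.

Lemma testfunZE (a : C) phi x : (a *: phi) x = a * phi x.
Proof. by []. Qed.

Lemma testfunNE phi x : (- phi) x = - phi x.
Proof. by []. Qed.

Lemma cderive0 (f : R -> C) : cderive 0 f = f.
Proof. by apply/funext => x; rewrite /cderive !derive1n0/=; case: (f x). Qed.

Lemma cderiveD n phi psi :
  cderive n (phi + psi) = cderive n phi + cderive n psi.
Proof.
have [sf1 sf2] := testfun_smooth phi; have [sg1 sg2] := testfun_smooth psi.
apply/funext => x; rewrite /cderive [RHS]/(_ + _)/=.
have -> : Re \o (phi + psi) = (Re \o phi) + (Re \o psi).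
  by apply/funext => z; exact: ReD.
have -> : Im \o (phi + psi) = (Im \o phi) + (Im \o psi).
  by apply/funext => z; exact: ImD.
by rewrite !derive1nD.
Qed.

Lemma cderive_Zreal n (a : R) phi :
  cderive n (a%:C%C *: phi) = (fun x => a%:C%C * cderive n phi x).
Proof.
have [sf1 sf2] := testfun_smooth phi.
apply/funext => x; rewrite /cderive.
have -> : Re \o (a%:C%C *: phi) = (fun=> a) * (Re \o phi).
  by apply/funext => z; exact: ReZ.
have -> : Im \o (a%:C%C *: phi) = (fun=> a) * (Im \o phi).
  by apply/funext => z; exact: ImZ.
by rewrite !derive1nZ//; apply/eqP; rewrite eq_complex/= !mul0r subr0 addr0 !eqxx.
Qed.

Lemma cderiveN n phi : cderive n (- phi) = (fun x => - cderive n phi x).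
Proof.
have -> : - phi = (-1)%:C%C *: phi by rewrite rmorphN1 scaleN1r.
by rewrite cderive_Zreal; apply/funext => x; rewrite rmorphN1 mulN1r.
Qed.

Lemma cderive_supp n (f : R -> C) b : (forall x, b < `|x| -> f x = 0) ->
  forall x, b < `|x| -> cderive n f x = 0.
Proof.
move=> f0 x bx; rewrite /cderive (@derive1n_supp _ _ b)//; last first.
  by move=> y yb; rewrite /= f0.
by rewrite (@derive1n_supp _ _ b)// => y yb; rewrite /= f0.
Qed.

Lemma tderive_subproof phi : cderive 1 phi \in @test_function R.
Proof.
have [s1 s2] := testfun_smooth phi; have [b phi0] := testfun_supp phi.
apply/test_functionP; split; last by exists b; exact: cderive_supp.
by split; exact: smooth_derive1.
Qed.

Definition tderive phi := TestFun (tderive_subproof phi).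

Lemma cderive_tderive n phi : cderive n (tderive phi) = cderive n.+1 phi.
Proof.
by apply/funext => x; rewrite /cderive !derive1Sn.
Qed.

Lemma cderive_iter n k phi : cderive n (iter k tderive phi) = cderive (n + k) phi.
Proof.
elim: k n => [|k IH] n; first by rewrite addn0.
by rewrite iterS cderive_tderive IH addSnnS.
Qed.

Lemma ttrans_subproof (a : R) phi : (fun x => phi (a + x)) \in @test_function R.
Proof.
have [s1 s2] := testfun_smooth phi; have [b phi0] := testfun_supp phi.
apply/test_functionP; split.
  have h1 := @smooth_shift _ a _ s1; have h2 := @smooth_shift _ a _ s2.
  by split.
exists (`|a| + b) => x bx; apply: phi0.
have := ler_normB (a + x) a; rewrite [a + x]addrC addrK; lra.
Qed.

(* ttrans a phi is the function y |-> phi (a + y) *)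
Definition ttrans (a : R) phi := TestFun (ttrans_subproof a phi).

Lemma cderive_ttrans n (a : R) phi :
  cderive n (ttrans a phi) = fun x => cderive n phi (a + x).
Proof.
have [s1 s2] := testfun_smooth phi.
apply/funext => x; rewrite /cderive.
have -> : Re \o ttrans a phi = fun x => (Re \o phi) (a + x) by [].
have -> : Im \o ttrans a phi = fun x => (Im \o phi) (a + x) by [].
by rewrite !derive1n_shift.
Qed.

Lemma ttrans_linear (a : R) : linear (ttrans a).
Proof. by move=> c phi psi; apply: testfun_ext. Qed.

Lemma ttransD (a b : R) phi : ttrans a (ttrans b phi) = ttrans (b + a) phi.
Proof. by apply: testfun_ext => x /=; rewrite addrA. Qed.

Lemma ttrans0 phi : ttrans 0 phi = phi.
Proof. by apply: testfun_ext => x /=; rewrite add0r. Qed.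

Lemma ttrans_tderive (a : R) phi : ttrans a (tderive phi) = tderive (ttrans a phi).
Proof. by apply: testfun_ext => x /=; rewrite cderive_ttrans. Qed.

Lemma tmul_subproof (h : R -> R) (sh : smooth h) phi :
  (fun x => (h x)%:C%C * phi x) \in @test_function R.
Proof.
have sphi := testfun_smooth phi; have [b phi0] := testfun_supp phi.
apply/test_functionP; split.
  apply: (@csmoothM _ (fun x => (h x)%:C%C) phi) => //.
  by split => //; exact: smooth_cst.
by exists b => x bx; rewrite phi0// mulr0.
Qed.

Definition tmul (h : R -> R) (sh : smooth h) phi := TestFun (tmul_subproof sh phi).

Lemma plateau_subproof (c r : R) (r0 : 0 < r) :
  (fun x => (plateau c r x)%:C%C) \in @test_function R.
Proof.
apply/test_functionP; split.
  by split; [exact: smooth_plateau|exact: smooth_cst].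
exists (`|c| + r) => x bx; rewrite plateau0//.
have := ler_normD (x - c) c; rewrite addrNK; lra.
Qed.

Definition tplateau (c r : R) (r0 : 0 < r) := TestFun (plateau_subproof c r0).

(* a genuine supremum, by supnorm_has_ub below *)
Definition supnorm n phi : R := sup (range (fun x => normc (cderive n phi x))).

Lemma supnorm_has_ub n phi :
  has_ubound (range (fun x => normc (cderive n phi x))).
Proof.
have [s1 s2] := testfun_smooth phi; have [b phi0] := testfun_supp phi.
have sn (f : R -> R) : smooth f -> smooth (derive1n n f).
  by elim: n => // m IH /IH; exact: smooth_derive1.
have [|B1 h1] := @smooth_bounded _ _ b (sn _ s1).
  by apply: derive1n_supp => x xb /=; rewrite phi0.
have [|B2 h2] := @smooth_bounded _ _ b (sn _ s2).
  by apply: derive1n_supp => x xb /=; rewrite phi0.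
exists (B1 + B2) => _ [x _ <-].
apply: le_trans (normc_le_ReIm _) _; exact: (lerD (h1 x) (h2 x)).
Qed.

Lemma le_supnorm n phi x : normc (cderive n phi x) <= supnorm n phi.
Proof. by apply: ub_le_sup; [exact: supnorm_has_ub|exists x]. Qed.

Lemma supnorm_le n phi (B : R) :
  (forall x, normc (cderive n phi x) <= B) -> supnorm n phi <= B.
Proof.
move=> h; apply: ge_sup; first by exists (normc (cderive n phi 0)); exists 0.
by move=> _ [x _ <-].
Qed.

Lemma supnorm_ge0 n phi : 0 <= supnorm n phi.
Proof. exact: le_trans (normc_ge0 _) (le_supnorm n phi 0). Qed.

Lemma supnorm_tderive n k phi : supnorm n (iter k tderive phi) = supnorm (n + k) phi.
Proof. by rewrite /supnorm cderive_iter. Qed.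

Lemma supnorm_ttrans n (a : R) phi : supnorm n (ttrans a phi) <= supnorm n phi.
Proof. by apply: supnorm_le => x; rewrite cderive_ttrans; exact: le_supnorm. Qed.

(* difference quotients of translates converge with all their derivatives *)
Lemma supnorm_quotient n (a h : R) phi : h != 0 ->
  supnorm n ((h^-1)%:C%C *: (ttrans (h + a) phi - ttrans a phi)
     - ttrans a (tderive phi)) <= `|h| * (2 * supnorm n.+2 phi).
Proof.
move=> h0; have [s1 s2] := testfun_smooth phi.
apply: supnorm_le => x.
have -> : cderive n ((h^-1)%:C%C *: (ttrans (h + a) phi - ttrans a phi)
     - ttrans a (tderive phi)) x =
  (h^-1)%:C%C * (cderive n phi (h + (a + x)) - cderive n phi (a + x)) -
  cderive n.+1 phi (a + x).
  rewrite cderiveD cderive_Zreal cderiveD !cderiveN.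
  by rewrite !cderive_ttrans cderive_tderive addrA.
have sn (f : R -> R) : smooth f -> smooth (derive1n n f).
  by elim: n => // m IH /IH; exact: smooth_derive1.
apply: le_trans (normc_le_ReIm _) _.
have -> : `|h| * (2 * supnorm n.+2 phi) =
  `|h| * supnorm n.+2 phi + `|h| * supnorm n.+2 phi by ring.
apply: lerD.
  have := @taylor1 _ _ (supnorm n.+2 phi) (a + x) h (sn _ s1) _ h0.
  rewrite -!derive1nS => H; apply: le_trans (H _).
    by rewrite ReD ReZ ReD !ReN.
  by move=> y; exact: le_trans (Re_le_normc _) (le_supnorm n.+2 phi y).
have := @taylor1 _ _ (supnorm n.+2 phi) (a + x) h (sn _ s2) _ h0.
rewrite -!derive1nS => H; apply: le_trans (H _).
  by rewrite ImD ImZ ImD !ImN.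
by move=> y; exact: le_trans (Im_le_normc _) (le_supnorm n.+2 phi y).
Qed.

End TestFunctionTheory.

Section Distributions.
Variable R : realType.
Local Notation C := R[i].
Local Notation Re := (@complex.Re R).
Local Notation Im := (@complex.Im R).
Local Notation normc := (@Normc.normc R).
Implicit Types (phi psi : testfun R) (T : testfun R -> C).

Definition seminorm (N : nat) phi : R := \sum_(k < N.+1) supnorm k phi.

(* continuity on D(R), as the order/seminorm estimate on each compact set *)
Definition distribution_continuous T := forall K : set R, compact K ->
  exists (N : nat) (c : R), forall phi, fsupport phi `<=` K ->
    normc (T phi) <= c * seminorm N phi.

Definition is_distribution T := linear T /\ distribution_continuous T.

(* the support is the complement of the largest open set on which T vanishes *)
Definition vanishes_on T (U : set R) :=
  forall phi, fsupport phi `<=` U -> T phi = 0.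

Definition dsupport T : set R :=
  ~` \bigcup_(U in [set U | open U /\ vanishes_on T U]) U.

Definition compact_distribution : {pred (testfun R -> C)} :=
  mem [set T | is_distribution T /\ compact (dsupport T)].

Lemma seminorm_ge0 N phi : 0 <= seminorm N phi.
Proof. by apply: sumr_ge0 => k _; exact: supnorm_ge0. Qed.

Lemma supnorm_seminorm k N phi : (k <= N)%N -> supnorm k phi <= seminorm N phi.
Proof.
move=> kN; rewrite /seminorm (bigD1 (Ordinal (kN : (k < N.+1)%N)))//= lerDl.
by apply: sumr_ge0 => i _; exact: supnorm_ge0.
Qed.


Lemma seminorm_le N phi (B : R) : (forall k, (k <= N)%N -> supnorm k phi <= B) ->
  seminorm N phi <= N.+1%:R * B.
Proof.
move=> h; rewrite /seminorm; apply: (@le_trans _ _ (\sum_(k < N.+1) B)).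
  by apply: ler_sum => k _; apply: h; rewrite -ltnS.
by rewrite sumr_const card_ord mulr_natl.
Qed.

Lemma linear_opB T : linear T -> T 0 = 0 /\ {morph T : x y / x + y}.
Proof.
move=> lT; have TD : {morph T : x y / x + y}.
  by move=> x y; rewrite -[x]scale1r lT !scale1r.
by split=> //; apply: (addIr (T 0)); rewrite -TD addr0 add0r.
Qed.

Lemma fsupport_closed_sub (f : R -> C) (A : set R) : closed A ->
  (forall x, ~ A x -> f x = 0) -> fsupport f `<=` A.
Proof.
move=> cA f0; rewrite ((closure_id A).1 cA); apply: closure_subset => x /= fx.
by apply: contrapT => /f0 fx0; move: fx; rewrite fx0 eqxx.
Qed.

(* a partition of unity argument *)
Lemma vanish_seq T (s : seq (R * R)) phi : linear T ->
  (forall p : R * R, p \in s -> 0 < p.2 /\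
    forall psi, (forall x, p.2 < `|x - p.1| -> psi x = 0) -> T psi = 0) ->
  (forall x, phi x != 0 -> has (fun p : R * R => `|x - p.1| <= p.2 / 2) s) ->
  T phi = 0.
Proof.
move=> lT; have [T0 TD] := linear_opB lT.
elim: s phi => [|[c r] s IH] phi hs hphi.
  have -> : phi = 0; last by [].
  by apply: testfun_ext => x; apply/eqP/negPn/negP => /hphi.
have [/= r0 hcr] := hs (c, r) (mem_head _ _).
have sp := @smooth_plateau R c r.
have sq : smooth ((fun=> 1) + (fun=> -1) * plateau c r).
  by apply: smoothD; [|apply: smoothM => //]; exact: smooth_cst.
have -> : phi = tmul sp phi + tmul sq phi.
  apply: testfun_ext => x; rewrite testfunDE /= -mulrDl -rmorphD/= !fctE.
  by rewrite mulN1r addrCA subrr addr0 mul1r.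
rewrite TD hcr ?add0r; last first.
  by move=> x /= rx; rewrite plateau0 ?mul0r// ltW.
apply: IH => [p ps|x /=]; first by apply: hs; rewrite inE ps orbT.
rewrite mulf_eq0 negb_or => /andP[px /hphi /= /orP[xc|//]].
by move: px; rewrite !fctE plateau1// mulN1r subrr eqxx.
Qed.

Lemma dsupport_vanish T phi : linear T ->
  compact (fsupport phi) -> fsupport phi `&` dsupport T = set0 -> T phi = 0.
Proof.
move=> lT cphi phiT.
pose good (c r : R) := 0 < r /\
  forall psi, (forall x, r < `|x - c| -> psi x = 0) -> T psi = 0.
have ex c : exists r : R, fsupport phi c -> good c r.
  have [cK|] := pselect (fsupport phi c); last by move=> h; exists 0 => /h.
  have : ~ dsupport T c by move=> cT; have : set0 c by rewrite -phiT.
  move=> /contrapT[U [oU UT] Uc].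
  have : nbhs c U by exact: open_nbhs_nbhs.
  move=> /nbhs_ballP[e /= e0 eU]; exists (e / 2) => _.
  split=> [|psi psi0]; first by rewrite divr_gt0.
  apply: UT; apply: (@subset_trans _ (closed_ball c (e / 2))).
    apply: fsupport_closed_sub; first exact: closed_ball_closed.
    move=> x; rewrite closed_ballE ?divr_gt0//= => /negP.
    by rewrite -ltNge distrC => /psi0.
  move=> x; rewrite closed_ballE ?divr_gt0//= => xe; apply: eU.
  by rewrite /ball/= (le_lt_trans xe)// ltr_pdivrMr// ltr_pMr// ltr1n.
have [r hr] := choice ex.
have := cphi; rewrite compact_cover => /(_ _ (fsupport phi) (fun c => ball c (r c / 2))).
case.
- by move=> c _; exact: ball_open.
- move=> x xK; exists x => //; apply: ballxx; rewrite divr_gt0//.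
  by case: (hr x xK).
move=> D DK cov.
apply: (@vanish_seq T [seq (c, r c) | c <- D] phi) => //.
  by move=> _ /mapP[c cD ->]; apply: hr; apply: set_mem; exact: DK.
move=> x phix; have [c cD xc] : cover [set` D] (fun c => ball c (r c / 2)) x.
  by apply: cov; exact: subset_closure.
apply/hasP; exists (c, r c); first by apply/mapP; exists c.
by rewrite /= distrC ltW.
Qed.

Lemma compact_dsupportP T : linear T -> compact (dsupport T) <->
  exists a : R, forall phi, (forall x, `|x| <= a -> phi x = 0) -> T phi = 0.
Proof.
move=> lT; split=> [/compact_bounded [b [_ hb]]|[a ha]].
  exists (b + 2) => phi phi0; apply: dsupport_vanish => //.
    apply/compact_fsupportP; exact: testfun_supp.
  apply/seteqP; split=> // x [xphi xT].
  have : `|x| <= b + 1 by apply: hb xT; rewrite ltrDl.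
  have : fsupport phi `<=` [set y | b + 2 <= `|y|].
    apply: fsupport_closed_sub.
      apply: (@closed_comp _ _ (fun y : R => `|y|) [set z | b + 2 <= z]).
        by move=> y _; exact: norm_continuous.
      exact: closed_ge.
    by move=> y /= /negP; rewrite -ltNge => /ltW /phi0.
  by move=> /(_ _ xphi)/=; lra.
apply: (@subclosed_compact _ _ `[- a, a]); last 1 first.
- move=> x xT; rewrite /= in_itv/= -ler_norml leNgt; apply/negP => ax.
  apply: xT; exists [set y : R | a < `|y|] => //; split.
    apply: (@open_comp _ _ (fun y : R => `|y|) [set z | a < z]).
      by move=> y _; exact: norm_continuous.
    exact: open_gt.
  move=> phi hphi; apply: ha => y ya; apply: fsupport0 => /hphi /=.
  by rewrite ltNge ya.
- apply: open_closedC; apply: bigcup_open => U [] //.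
- exact: segment_compact.
Qed.

Lemma compact_distributionP T : reflect
  [/\ linear T, distribution_continuous T &
   exists a : R, forall phi, (forall x, `|x| <= a -> phi x = 0) -> T phi = 0]
  (T \in compact_distribution).
Proof.
apply: (iffP idP) => [/set_mem[[lT cT] /compact_dsupportP]|[lT cT sT]].
  by move=> /(_ lT).
by apply/mem_set; split=> //; exact/compact_dsupportP.
Qed.

(* continuity may be tested on large intervals *)
Lemma distribution_continuousE T : distribution_continuous T <->
  forall b : R, exists (N : nat) (c : R), 0 <= c /\
    forall phi, (forall x, b < `|x| -> phi x = 0) ->
    normc (T phi) <= c * seminorm N phi.
Proof.
split=> [cT b|h K cK].
  have [N [c hc]] := cT _ (@segment_compact R (- b) b).
  exists N, `|c|; split => // phi phi0.
  apply: le_trans (hc phi _) _.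
    apply: fsupport_closed_sub; first exact: interval_closed.
    by move=> x /=; rewrite in_itv/= -ler_norml => /negP; rewrite -ltNge => /phi0.
  by rewrite ler_wpM2r ?seminorm_ge0// ler_norm.
have [b [_ hb]] := compact_bounded cK.
have [N [c [_ hc]]] := h (b + 1).
exists N, c => phi phiK; apply: hc => x bx; apply: fsupport0 => /phiK xK.
have b1 : b < b + 1 by rewrite ltrDl.
by have := hb (b + 1) b1 x xK; rewrite /= leNgt bx.
Qed.

Lemma seminorm_mono N M phi : (N <= M)%N -> seminorm N phi <= seminorm M phi.
Proof.
move=> NM; rewrite /seminorm -!(big_mkord xpredT (fun k => supnorm k phi)).
rewrite [leRHS](big_cat_nat (n := N.+1))//= lerDl.
by apply: sumr_ge0 => k _; exact: supnorm_ge0.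
Qed.

Lemma compact_distribution_submod : GRing.submod_closed compact_distribution.
Proof.
split.
  apply/compact_distributionP; split.
  - by move=> a phi psi; rewrite scaler0 addr0.
  - move=> K _; exists 0%N, 0 => phi _; rewrite mul0r.
    by rewrite [X in normc X](_ : _ = 0)// Normc.normc0.
  - by exists 0.
move=> a S T /compact_distributionP[lS /distribution_continuousE cS [s hs]].
move=> /compact_distributionP[lT /distribution_continuousE cT [t ht]].
have E phi : (a *: S + T) phi = a * S phi + T phi by [].
apply/compact_distributionP; split.
- move=> b phi psi; rewrite !E lS lT mulrDr scalerDr addrACA; congr (_ + _ + _).
  by rewrite /GRing.scale/= mulrCA.
- apply/distribution_continuousE => b.
  have [N [c [c0 hc]]] := cS b; have [M [d [d0 hd]]] := cT b.
  exists (maxn N M), (normc a * c + d); split.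
    by rewrite addr_ge0// mulr_ge0// normc_ge0.
  move=> phi phi0; rewrite E mulrDl.
  apply: le_trans (normcD _ _) _; apply: lerD.
    rewrite Normc.normcM -mulrA ler_wpM2l ?normc_ge0//.
    apply: le_trans (hc _ phi0) _.
    by rewrite ler_wpM2l// seminorm_mono// leq_maxl.
  apply: le_trans (hd _ phi0) _.
  by rewrite ler_wpM2l// seminorm_mono// leq_maxr.
exists (Num.max s t) => phi phi0; rewrite E hs ?ht ?mulr0 ?addr0// => x xm;
  by apply: phi0; rewrite le_max xm ?orbT.
Qed.

HB.instance Definition _ := GRing.isSubmodClosed.Build C (testfun R -> C)
  compact_distribution compact_distribution_submod.

(* the space E'(R) of distributions on R with compact support *)
Record cdist := CDist {
  cdist_val :> testfun R -> C ;
  cdistP : cdist_val \in compact_distribution }.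

HB.instance Definition _ := [isSub for cdist_val].
HB.instance Definition _ := [Choice of cdist by <:].
HB.instance Definition _ := [SubChoice_isSubLmodule of cdist by <:].

End Distributions.

Section Convolution.
Variable R : realType.
Local Notation C := R[i].
Local Notation Re := (@complex.Re R).
Local Notation Im := (@complex.Im R).
Local Notation normc := (@Normc.normc R).
Implicit Types (phi psi : testfun R) (S T U : cdist R).

Lemma cdist_linear T : linear T.
Proof. by case: T => T /= /compact_distributionP[]. Qed.

Lemma cdist_continuous T : distribution_continuous T.
Proof. by case: T => T /= /compact_distributionP[]. Qed.

Lemma cdist_supp T :
  exists a : R, forall phi, (forall x, `|x| <= a -> phi x = 0) -> T phi = 0.
Proof. by case: T => T /= /compact_distributionP[]. Qed.

Lemma cdistD T phi psi : T (phi + psi) = T phi + T psi.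
Proof. by have := cdist_linear T 1 phi psi; rewrite !scale1r. Qed.

Lemma cdist0 T : T 0 = 0.
Proof. by have [] := linear_opB (cdist_linear T). Qed.

Lemma cdistZ T (a : C) phi : T (a *: phi) = a * T phi.
Proof. by have := cdist_linear T a phi 0; rewrite !addr0 cdist0 addr0. Qed.

Lemma cdistN T phi : T (- phi) = - T phi.
Proof. by rewrite -scaleN1r cdistZ mulN1r. Qed.

Lemma cdist_ext S T : S =1 T -> S = T.
Proof. by move=> h; apply: val_inj; apply/funext. Qed.

Definition conv_fun T phi (x : R) : C := T (ttrans x phi).

Lemma is_derive_conv_fun T phi (L : C -> R) (x : R) :
  (forall z w, L (z + w) = L z + L w) ->
  (forall (a : R) z, L (a%:C%C * z) = a * L z) ->
  (forall z, L (- z) = - L z) ->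
  (forall z, `|L z| <= normc z) ->
  is_derive x 1 (fun x => L (conv_fun T phi x)) (L (conv_fun T (tderive phi) x)).
Proof.
move=> LD LZ LN Lle.
have [b phi0] := testfun_supp phi.
have [N [c [c0 hc]]] :=
  (distribution_continuousE T).1 (@cdist_continuous T) (`|x| + 1 + b).
set f := fun x => L (conv_fun T phi x); set d := L _.
pose D := c * (N.+1%:R * (2 * seminorm N.+2 phi)).
have D0 : 0 <= D by rewrite !mulr_ge0// seminorm_ge0.
have key (h : R) : h != 0 -> `|h| <= 1 ->
    `|h^-1 * (f (h + x) - f x) - d| <= D * `|h|.
  move=> h0 h1.
  set q := (h^-1)%:C%C *: (ttrans (h + x) phi - ttrans x phi)
     - ttrans x (tderive phi).
  have -> : h^-1 * (f (h + x) - f x) - d = L (T q).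
    by rewrite /q cdistD cdistZ cdistD !cdistN LD LZ LD !LN.
  apply: le_trans (Lle _) _; apply: le_trans (hc q _) _.
    move=> y hy; rewrite /q testfunDE testfunZE testfunDE !testfunNE /=.
    have yE : y = (h + x + y) - h - x by ring.
    have yE' : y = (x + y) - x by ring.
    have n1 : `|y| <= `|h + x + y| + `|h| + `|x|.
      by rewrite [in leLHS]yE (le_trans (ler_normB _ _))// lerD2r ler_normB.
    have n2 : `|y| <= `|x + y| + `|x| by rewrite [in leLHS]yE' ler_normB.
    rewrite phi0; last by lra.
    rewrite phi0; last by lra.
    rewrite (@cderive_supp _ 1 phi b)//; last by lra.
    by rewrite subrr mulr0 subrr.
  rewrite /D -!mulrA ler_wpM2l//.
  have -> : N.+1%:R * (2 * (seminorm N.+2 phi * `|h|)) =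
    N.+1%:R * (`|h| * (2 * seminorm N.+2 phi)) by ring.
  apply: seminorm_le => k kN; apply: le_trans (supnorm_quotient _ _ _ h0) _.
  by rewrite !ler_wpM2l// supnorm_seminorm// !ltnS.
have cv : h^-1 *: (f (h *: 1 + x) - f x) @[h --> (0:R)^'] --> d.
  apply/cvgrPdist_le => e e0; near=> h.
  have h0 : h != 0 by near: h; exact: nbhs_dnbhs_neq.
  have h1 : `|h| <= 1 by near: h; apply: dnbhs0_le.
  have h2 : `|h| <= e / (D + 1).
    by near: h; apply: dnbhs0_le; rewrite divr_gt0// ltr_wpDl.
  rewrite distrC /GRing.scale/= mulr1; apply: le_trans (key h h0 h1) _.
  have D1 : 0 < D + 1 by rewrite ltr_wpDl.
  move: h2; rewrite ler_pdivlMr// mulrDr mulr1 mulrC.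
  have : 0 <= `|h| by []. lra.
apply: DeriveDef; first by apply/cvg_ex; exists d.
exact: cvg_lim cv.
Unshelve. all: by end_near. Qed.

Lemma is_derive_Re_conv T phi (x : R) :
  is_derive x 1 (fun x => Re (conv_fun T phi x)) (Re (conv_fun T (tderive phi) x)).
Proof.
apply: is_derive_conv_fun.
- exact: ReD.
- exact: ReZ.
- exact: ReN.
- exact: Re_le_normc.
Qed.

Lemma is_derive_Im_conv T phi (x : R) :
  is_derive x 1 (fun x => Im (conv_fun T phi x)) (Im (conv_fun T (tderive phi) x)).
Proof.
apply: is_derive_conv_fun.
- exact: ImD.
- exact: ImZ.
- exact: ImN.
- exact: Im_le_normc.
Qed.

Lemma csmooth_conv_fun T phi : csmooth (conv_fun T phi).
Proof.
split; apply/smoothP => n.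
  elim: n phi => //= n IH phi.
  by exists (Re \o conv_fun T (tderive phi)) => // x; exact: is_derive_Re_conv.
elim: n phi => //= n IH phi.
by exists (Im \o conv_fun T (tderive phi)) => // x; exact: is_derive_Im_conv.
Qed.

Lemma cderive_conv_fun n T phi :
  cderive n (conv_fun T phi) = conv_fun T (iter n (@tderive R) phi).
Proof.
have hRe : derive1n n (Re \o conv_fun T phi) =
    Re \o conv_fun T (iter n (@tderive R) phi).
  elim: n => // n IH; rewrite derive1nS IH iterS.
  by apply: is_derive_derive1 => x; exact: is_derive_Re_conv.
have hIm : derive1n n (Im \o conv_fun T phi) =
    Im \o conv_fun T (iter n (@tderive R) phi).
  elim: n {hRe} => // n IH; rewrite derive1nS IH iterS.
  by apply: is_derive_derive1 => x; exact: is_derive_Im_conv.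
apply/funext => x; rewrite /cderive hRe hIm /=.
by case: (conv_fun _ _ _).
Qed.

Lemma conv_fun_supp T (a b : R) phi :
  (forall psi, (forall x, `|x| <= a -> psi x = 0) -> T psi = 0) ->
  (forall x, b < `|x| -> phi x = 0) ->
  forall x, a + b < `|x| -> conv_fun T phi x = 0.
Proof.
move=> Ta phib x xab; apply: Ta => y ya /=; apply: phib.
have := ler_normB (x + y) y; rewrite addrK; lra.
Qed.

Lemma conv_fun_subproof T phi : conv_fun T phi \in @test_function R.
Proof.
apply/test_functionP; split; first exact: csmooth_conv_fun.
have [a Ta] := cdist_supp T; have [b phib] := testfun_supp phi.
by exists (a + b); exact: conv_fun_supp.
Qed.

(* the test function x |-> T (y |-> phi (x + y)) *)
Definition conv_test T phi := TestFun (conv_fun_subproof T phi).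

Lemma conv_test_linear T : linear (conv_test T).
Proof.
move=> a phi psi; apply: testfun_ext => x.
by rewrite testfunDE testfunZE /= /conv_fun ttrans_linear cdistD cdistZ.
Qed.

Lemma conv_subproof S T :
  (fun phi => S (conv_test T phi)) \in @compact_distribution R.
Proof.
have [s Ss] := cdist_supp S; have [t Tt] := cdist_supp T.
apply/compact_distributionP; split.
- by move=> a phi psi; rewrite conv_test_linear cdist_linear.
- apply/distribution_continuousE => b.
  have [N [c [c0 hc]]] :=
    (distribution_continuousE S).1 (@cdist_continuous S) (t + b).
  have [M [d [d0 hd]]] :=
    (distribution_continuousE T).1 (@cdist_continuous T) (`|t + b| + b).
  exists (M + N)%N, (c * (N.+1%:R * (d * M.+1%:R))).
  split; first by rewrite !mulr_ge0.
  move=> phi phi0; apply: le_trans (hc (conv_test T phi) _) _.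
    exact: (conv_fun_supp Tt phi0).
  rewrite -!mulrA ler_wpM2l//; apply: seminorm_le => k kN.
  apply: supnorm_le => x; rewrite cderive_conv_fun.
  set psi := iter k _ _.
  have psi0 y : b < `|y| -> psi y = 0.
    have -> : psi y = cderive k phi y.
      by rewrite -[psi y]/((psi : R -> C) y) -[psi : R -> C]cderive0 cderive_iter.
    exact: cderive_supp.
  have [xtb|xtb] := leP `|x| `|t + b|; last first.
    rewrite (conv_fun_supp Tt psi0) ?Normc.normc0.
      by rewrite !mulr_ge0// seminorm_ge0.
    by rewrite (le_lt_trans _ xtb)// ler_norm.
  apply: le_trans (hd _ _) _.
    move=> y hy /=; apply: psi0.
    have := ler_normB (x + y) x; rewrite [x + y]addrC addrK; lra.
  rewrite ler_wpM2l//; apply: seminorm_le => j jM.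
  apply: le_trans (supnorm_ttrans _ _ _) _; rewrite supnorm_tderive.
  by rewrite supnorm_seminorm// leq_add.
exists (s + t + 1) => phi phi0; apply: Ss => x xs; apply: Tt => y yt /=.
apply: phi0; rewrite (le_trans (ler_normD _ _))//; lra.
Qed.

(* (S * T) phi = S_x (T_y (phi (x + y))) *)
Definition conv S T : cdist R := CDist (conv_subproof S T).

Lemma convE S T phi : conv S T phi = S (conv_test T phi).
Proof. by []. Qed.

Lemma dirac_subproof (a : R) :
  (fun phi : testfun R => phi a) \in @compact_distribution R.
Proof.
apply/compact_distributionP; split.
- by move=> b phi psi.
- apply/distribution_continuousE => b; exists 0%N, 1; split=> // phi _.
  rewrite mul1r; apply: le_trans (supnorm_seminorm phi (leq0n 0)).
  by rewrite -[in leLHS](@cderive0 _ phi) le_supnorm.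
- by exists `|a| => phi; apply.
Qed.

(* the Dirac distribution at a *)
Definition cdirac (a : R) : cdist R := CDist (dirac_subproof a).

Lemma convA : associative conv.
Proof.
move=> S T U; apply: cdist_ext => phi; rewrite !convE.
congr (S _); apply: testfun_ext => x; rewrite /= /conv_fun /=.
congr (T _); apply: testfun_ext => y /=; rewrite /conv_fun.
by rewrite ttransD.
Qed.

Lemma conv1d : left_id (cdirac 0) conv.
Proof.
move=> T; apply: cdist_ext => phi; rewrite convE /= /conv_fun.
by rewrite ttrans0.
Qed.

Lemma convd1 : right_id (cdirac 0) conv.
Proof.
move=> T; apply: cdist_ext => phi; rewrite convE; congr (T _).
by apply: testfun_ext => x; rewrite /= /conv_fun/= addr0.
Qed.

Lemma convDl : left_distributive conv +%R.
Proof. by move=> S T U; apply: cdist_ext. Qed.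

Lemma convDr : right_distributive conv +%R.
Proof.
move=> S T U; apply: cdist_ext => phi.
rewrite -[RHS]/(S (conv_test T phi) + S (conv_test U phi)) -cdistD convE.
by congr (S _); apply: testfun_ext.
Qed.

Lemma cdirac_neq0 : cdirac 0 != 0.
Proof.
apply/eqP => /(congr1 (fun T : cdist R => T (tplateau 0 ltr01))).
rewrite -[RHS]/(0 : C) /= plateau1//; last by rewrite subrr normr0 divr_ge0.
by move/eqP; rewrite eq_complex /= oner_eq0.
Qed.

(* E'(R) under convolution, with unity the Dirac distribution at 0 *)
HB.instance Definition _ := GRing.Zmodule_isNzRing.Build (cdist R)
  convA conv1d convd1 convDl convDr cdirac_neq0.

Lemma cdist_mulE S T phi : (S * T) phi = S (conv_test T phi).
Proof. by []. Qed.

Lemma cdist_oneE phi : (1 : cdist R) phi = phi 0.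
Proof. by []. Qed.

Lemma conv_scalel (a : C) S T : a *: (S * T) = (a *: S) * T.
Proof. by apply: cdist_ext. Qed.

HB.instance Definition _ := GRing.Lmodule_isLalgebra.Build C (cdist R) conv_scalel.

Lemma conv_scaler (a : C) S T : a *: (S * T) = S * (a *: T).
Proof.
apply: cdist_ext => phi; rewrite -[LHS]/(a * S (conv_test T phi)) -cdistZ.
by rewrite cdist_mulE; congr (S _); apply: testfun_ext.
Qed.

HB.instance Definition _ := GRing.Lalgebra_isAlgebra.Build C (cdist R) conv_scaler.

End Convolution.

(* invertibility in a possibly noncommutative unital algebra *)
Definition alg_unit (F : fieldType) (A : algType F) (u : A) : Prop :=
  exists v : A, u * v = 1 /\ v * u = 1.

Definition GKZ_algebra (F : fieldType) (A : algType F) : Prop :=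
  forall Lambda : {scalar A},
    (forall u : A, alg_unit u -> Lambda u <> 0) -> Lambda 1 = 1 ->
    forall a b : A, Lambda (a * b) = Lambda a * Lambda b.

(* Main.v *)
(* The functional is T |-> T(1 + i x), which is not multiplicative on Dirac
   measures. A unit u has, at every polynomial f, the value m f(alpha) of a
   multiple of a Dirac measure at a real point alpha. Indeed the exponential
   generating series F and G of the moments of u and of its inverse satisfy
   F G = 1 and have coefficients O(B^n / n!). The N-th truncations of F and G
   therefore have product 1 + O(X^(N+1)) with a very small tail, so the roots of
   the truncation of F have modulus at least c N: it is F(0) times a product of
   at most N factors 1 - w X with |w| <= K / N. Such a product satisfies
   p' = p_1 p up to terms quadratic in the w's, of total size O(1 / N); letting N
   grow gives F' F(0) = F'(0) F, hence m_n = m alpha^n. Continuity of u on powers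
   of a polynomial bounded by 1 near its support makes alpha real. *)
Require Import Defs.
From HB Require Import structures.
From mathcomp Require Import all_boot all_order all_algebra.
From mathcomp Require Import all_classical all_reals all_analysis.
From mathcomp Require Import complex ring lra zify.
Set Implicit Arguments.
Unset Strict Implicit.
Unset Printing Implicit Defensive.
Import Order.TTheory GRing.Theory Num.Theory.
Import numFieldNormedType.Exports.
Local Open Scope ring_scope.
Local Open Scope classical_set_scope.

(** * Polynomial growth of derivatives of powers *)

Section PolynomialGrowth.
Variable R : realType.
Local Notation C := R[i].
Local Notation normc := (@Normc.normc R).

(** One term of the exponential series is at most its sum; with x = n this gives n^n <= n! e^n. *)
Lemma expn_le_fact_expR (x : R) n : 0 <= x -> x ^+ n <= n`!%:R * expR x.
Proof.
move=> x0; case: n => [|n]; first by rewrite expr0 mul1r -expR0 ler_expR.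
have f0 : 0 < (n.+1)`!%:R :> R by rewrite ltr0n fact_gt0.
rewrite -ler_pdivrMl// mulrC (le_trans _ (expR_ge1Dxn n x0))//.
by rewrite lerDr.
Qed.

(** With l = ln beta, ((n+1) l)^(N+1) <= (N+1)! beta^(n+1); a bound of order (n+1)^N would leave one
    factor n+1 bounded. *)
Lemma exponential_not_polynomial (m beta c : R) N : 0 < m -> 1 < beta ->
  ~ forall n, m * beta ^+ n <= c * n.+1%:R ^+ N.
Proof.
move=> m0 b1 h.
have b0 : 0 < beta by apply: lt_trans b1.
pose l := ln beta; have l0 : 0 < l by rewrite ln_gt0.
have g n : n.+1%:R <= c * (N.+1)`!%:R * beta / (l ^+ N.+1 * m).
  have n0 : 0 < n.+1%:R :> R by [].
  rewrite ler_pdivlMr ?mulr_gt0 ?exprn_gt0//.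
  rewrite -(ler_pM2r (exprn_gt0 N n0)).
  have : (n.+1%:R * l) ^+ N.+1 <= (N.+1)`!%:R * expR (n.+1%:R * l).
    by apply: expn_le_fact_expR; rewrite mulr_ge0// ltW.
  rewrite expRM_natl lnK ?posrE// exprMn => h1.
  have f0 : 0 <= (N.+1)`!%:R * beta by rewrite mulr_ge0// ltW.
  have h2 := ler_wpM2l f0 (h n).
  have h3 := ler_wpM2r (ltW m0) h1.
  rewrite exprS in h3.
  have -> : n.+1%:R * (l ^+ N.+1 * m) * n.+1%:R ^+ N =
    n.+1%:R * n.+1%:R ^+ N * l ^+ N.+1 * m by ring.
  apply: le_trans h3 _; apply: le_trans (_ : _ <= (N.+1)`!%:R * beta * (m * beta ^+ n)) _.
    by rewrite exprS; have -> : (N.+1)`!%:R * (beta * beta ^+ n) * m =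
      (N.+1)`!%:R * beta * (m * beta ^+ n) by ring.
  apply: le_trans h2 _.
  by have -> : (N.+1)`!%:R * beta * (c * n.+1%:R ^+ N) =
    c * (N.+1)`!%:R * beta * n.+1%:R ^+ N by ring.
have X0 := le_trans (ler0n _ _) (g 0%N).
have := archi_boundP X0; set k := Num.bound _ => /(le_lt_trans (g k)).
by rewrite ltr_nat => /ltnW; rewrite ltnn.
Qed.

Lemma smoothX (h : R -> R) n : smooth h -> smooth (h ^+ n).
Proof.
move=> sh; elim: n => [|n IH]; first exact: smooth_cst.
by rewrite exprS; exact: smoothM.
Qed.

(** Induction on [k] for all [g] at once: (g h^n)' = g' h^n + n (g h') h^(n-1) has two terms of the
    same form, and the factor n costs one power of n+1. *)
Lemma derive1n_powers_bound (h : R -> R) (b : R) k (g : R -> R) :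
  smooth h -> (forall x, `|x| <= b -> `|h x| <= 1) ->
  smooth g -> (forall x, b < `|x| -> g x = 0) ->
  exists c : R, forall n x, `|(g * h ^+ n)^`(k) x| <= c * n.+1%:R ^+ k.
Proof.
move=> sh h1; elim: k g => [|k IH] g sg g0.
  have [B hB] := smooth_bounded sg g0; exists B => n x.
  rewrite derive1n0 expr0 mulr1 fctE exprfctE normrM normrX.
  have [xb|bx] := leP `|x| b; last first.
    by rewrite g0// normr0 mul0r; apply: le_trans (hB x).
  apply: le_trans (hB x); rewrite ler_piMr// exprn_ile1//; exact: h1.
have [|c1 hc1] := IH _ (smooth_derive1 sg).
  by move=> x bx; have := @derive1n_supp _ _ _ 1 g0 x bx; rewrite derive1n1.
have [||c2 hc2] := IH (g * derive1 h).
- by apply: smoothM => //; exact: smooth_derive1.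
- by move=> x bx; rewrite fctE g0// mul0r.
exists (c1 + c2) => n x.
have D : (g * h ^+ n)^`() =
    derive1 g * h ^+ n + (fun=> n%:R) * (g * derive1 h * h ^+ n.-1).
  apply: is_derive_derive1 => y.
  have dh := smooth_is_derive sh y; have dg := smooth_is_derive sg y.
  have dhn : is_derive y 1 (h ^+ n) (n%:R * h y ^+ n.-1 * (derive1 h y)).
    by apply: is_derive_eq; rewrite /GRing.scale/= mulr_natl.
  apply: (is_derive_eq (is_deriveM dg dhn)).
  have ringE (r s t p q : R) : r * (n%:R * p * s) + q * t = t * q + n%:R * (r * s * p).
    by ring.
  by rewrite [LHS]ringE !exprfctE.
rewrite derive1Sn D.
have s1 : smooth (derive1 g * h ^+ n) by apply: smoothM; [exact: smooth_derive1|exact: smoothX].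
have s2 : smooth (g * derive1 h * h ^+ n.-1).
  by apply: smoothM; [apply: smoothM => //; exact: smooth_derive1|exact: smoothX].
rewrite derive1nD//; last by apply: smoothM => //; exact: smooth_cst.
rewrite derive1nZ// fctE; apply: le_trans (ler_normD _ _) _.
rewrite mulrDl; apply: lerD.
  apply: le_trans (hc1 n x) _.
  have c10 : 0 <= c1 by have := hc1 0%N 0; rewrite expr1n mulr1; apply: le_trans.
  by rewrite ler_wpM2l// ler_weXn2l// ler1n.
have c20 : 0 <= c2 by have := hc2 0%N 0; rewrite expr1n mulr1; apply: le_trans.
(* For n = 0 the truncated exponent [n.-1] is harmless, since the factor n is zero. *)
rewrite fctE normrM normr_nat; case: n {D s1 s2 hc1} => [|n].
  by rewrite mul0r mulr_ge0// exprn_ge0.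
apply: (@le_trans _ _ (n.+2%:R * (c2 * n.+2%:R ^+ k))); last first.
  by rewrite exprS mulrCA.
rewrite ler_pM// ?ler_nat//; apply: le_trans (hc2 _ _) _.
by rewrite ler_wpM2l// lerXn2r ?nnegrE// ler_nat.
Qed.

End PolynomialGrowth.

(** * Invertible power series of exponential type *)

Section UnitSeries.
Variable R : realType.
Local Notation C := R[i].
Local Notation normc := (@Normc.normc R).
Implicit Types (a b : nat -> C) (p q : {poly C}).

Lemma normc_nat n : normc n%:R = n%:R.
Proof. by rewrite -(rmorph_nat (real_complex R)) /= expr0n/= addr0 sqrtr_sqr normr_nat. Qed.

Lemma normc_le_sum (I : Type) (r : seq I) (P : pred I) (F : I -> C) :
  normc (\sum_(i <- r | P i) F i) <= \sum_(i <- r | P i) normc (F i).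
Proof.
elim/big_rec2: _ => [|i x y _ h]; first by rewrite Normc.normc0.
by apply: le_trans (le_normcD _ _) _; rewrite lerD2l.
Qed.

Lemma normcX (z : C) n : normc (z ^+ n) = normc z ^+ n.
Proof.
elim: n => [|n IH]; first by rewrite !expr0 Normc.normc1.
by rewrite !exprS Normc.normcM IH.
Qed.

(** * Products of linear factors with constant term 1, indexed by inverse roots *)

Definition prodXw (s : seq C) : {poly C} := \prod_(w <- s) (1 - w *: 'X).

Lemma coef_prodXw_cons w s k :
  (prodXw (w :: s))`_k = (prodXw s)`_k - w * (if k is j.+1 then (prodXw s)`_j else 0).
Proof.
rewrite /prodXw big_cons mulrBl mul1r -scalerAl coefB coefZ.
by rewrite (mulrC 'X) coefMX; case: k.
Qed.

Lemma prodXw_coef0 s : (prodXw s)`_0 = 1.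
Proof.
elim: s => [|w s IH]; first by rewrite /prodXw big_nil coef1.
by rewrite coef_prodXw_cons mulr0 subr0.
Qed.

(** Up to sign the coefficient is the k-th elementary symmetric function of the w's. One more factor
    is absorbed by n^(k+1) + n^k <= (n+1)^(k+1). *)
Lemma prodXw_coef_bound (d : R) s k : 0 <= d ->
  (forall w, w \in s -> normc w <= d) ->
  normc (prodXw s)`_k <= ((size s)%:R * d) ^+ k.
Proof.
move=> d0; elim: s k => [|w s IH] k hs.
  by rewrite /prodXw big_nil coef1 mul0r expr0n normc_nat.
have hw : normc w <= d by apply: hs; rewrite mem_head.
have {}IH j : normc (prodXw s)`_j <= ((size s)%:R * d) ^+ j.
  by apply: IH => z zs; apply: hs; rewrite inE zs orbT.
rewrite coef_prodXw_cons; case: k => [|k].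
  by rewrite mulr0 subr0 expr0 prodXw_coef0 Normc.normc1.
apply: le_trans (le_normcD _ _) _; rewrite normcN Normc.normcM.
apply: (@le_trans _ _ (((size s)%:R * d) ^+ k.+1 + d * ((size s)%:R * d) ^+ k)).
  by apply: lerD; rewrite ?IH// ler_pM// normc_ge0.
rewrite exprS -mulrDl -[X in _ * d + X]mul1r -mulrDl -natr1 /= exprS.
by apply: ler_wpM2l; rewrite ?lerXn2r ?nnegrE ?mulr_ge0 ?addr_ge0//
  ler_wpM2r// lerDl.
Qed.

(* For [p = prod (1 - w X)] the polynomial [p' - p_1 p] satisfies
   [D((1 - w X) p) = (1 - w X) D(p) - w^2 X p]: it is quadratic in the [w]'s. *)
Lemma prodXw_deriv_bound (d : R) s k : 0 <= d ->
  (forall w, w \in s -> normc w <= d) ->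
  normc (k.+1%:R * (prodXw s)`_k.+1 - (prodXw s)`_1 * (prodXw s)`_k) <=
    k%:R * (size s)%:R ^+ k * d ^+ k.+1.
Proof.
move=> d0; elim: s k => [|w s IH] k hs.
  rewrite /prodXw big_nil !coef1 /= mulr0 mul0r subr0 Normc.normc0.
  by rewrite !mulr_ge0// exprn_ge0.
have hw : normc w <= d by apply: hs; rewrite mem_head.
have hs' z : z \in s -> normc z <= d by move=> zs; apply: hs; rewrite inE zs orbT.
case: k => [|k].
  by rewrite prodXw_coef0 mul1r mulr1 subrr Normc.normc0 !mul0r.
set p := prodXw s; set n := size s.
have pb := prodXw_coef_bound k d0 hs'.
have D1 := IH k.+1 hs'; have D0 := IH k hs'.
rewrite !coef_prodXw_cons -/p in D1 D0 pb *; rewrite -/n in D1 D0 pb *.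
set P2 := k.+2%:R * p`_k.+2 - p`_1 * p`_k.+1 in D1.
set P1 := k.+1%:R * p`_k.+1 - p`_1 * p`_k in D0.
(* The identity above at degree k+1; [P2] and [P1] are the coefficients of D(p) at degrees k+1 and
   k. *)
have -> : k.+2%:R * (p`_k.+2 - w * p`_k.+1) -
    (p`_1 - w * p`_0) * (p`_k.+1 - w * p`_k) = P2 - w * P1 - w ^+ 2 * p`_k.
  rewrite /P1 /P2 {2}/p prodXw_coef0.
  rewrite -[k.+2%:R]natr1; ring.
apply: le_trans (le_normcD _ _) _; rewrite normcN Normc.normcM normcX.
apply: le_trans (lerD (le_normcD _ _) (lexx _)) _.
rewrite normcN Normc.normcM.
apply: (@le_trans _ _ (k.+1%:R * n%:R ^+ k.+1 * d ^+ k.+2 +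
   d * (k%:R * n%:R ^+ k * d ^+ k.+1) + d ^+ 2 * (n%:R * d) ^+ k)).
  apply: lerD; first by apply: lerD => //; rewrite ler_pM// normc_ge0.
  by rewrite ler_pM ?exprn_ge0 ?normc_ge0// lerXn2r// nnegrE ?normc_ge0.
rewrite exprMn_comm; last exact: mulrC.
have -> : k.+1%:R * n%:R ^+ k.+1 * d ^+ k.+2 +
   d * (k%:R * n%:R ^+ k * d ^+ k.+1) + d ^+ 2 * (n%:R ^+ k * d ^+ k) =
   k.+1%:R * (n.+1%:R * n%:R ^+ k) * d ^+ k.+2.
  by rewrite -[n.+1%:R]natr1 -[k.+1%:R]natr1 !exprS; ring.
rewrite ler_wpM2r ?exprn_ge0// ler_wpM2l// exprS ler_wpM2l//.
by rewrite lerXn2r ?nnegrE// ler_nat.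
Qed.

Lemma poly_prodXw p : p`_0 != 0 -> exists2 s : seq C,
  p = p`_0 *: prodXw s & (size s < size p)%N /\
  forall w, w \in s -> exists2 z, root p z & w = z^-1.
Proof.
move=> p0; have pn0 : p != 0 by apply: contraNneq p0 => ->; rewrite coef0.
have [r pr] := closed_field_poly_normal p.
have lc0 : lead_coef p != 0 by rewrite lead_coef_eq0.
have rt z : z \in r -> root p z.
  by move=> zr; rewrite pr rootZ// root_prod_XsubC.
have r0 z : z \in r -> z != 0.
  by move=> /rt; apply: contraTneq => ->; rewrite /root horner_coef0.
exists [seq z^-1 | z <- r]; last first.
  split.
    by rewrite size_map pr size_scale// size_prod_XsubC.
  by move=> _ /mapP[z zr ->]; exists z => //; exact: rt.
(* Each root is nonzero, so X - z = -z (1 - X/z). The scalar is left free in the induction and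
   identified afterwards by the constant terms. *)
have e : exists c, p = c *: prodXw [seq z^-1 | z <- r].
  rewrite pr; move: (lead_coef p) => c {pr pn0 lc0 p0 rt}.
  elim: r c r0 => [|z r IH] c r0.
    by exists c; rewrite /prodXw !big_nil.
  have z0 : z != 0 by apply: r0; rewrite mem_head.
  have [|c' e] := IH (- z * c); first by move=> y yr; apply: r0; rewrite inE yr orbT.
  exists c'; rewrite /prodXw map_cons !big_cons -/(prodXw _) [RHS]scalerAr -e.
  have -> : 'X - z%:P = - z *: (1 - z^-1 *: 'X).
    by rewrite scalerBr scalerA mulNr divff// scaleN1r opprK addrC scaleNr alg_polyC.
  by rewrite -scalerAl -scalerAr !scalerA mulrC.
case: e => c e; suff -> : p`_0 = c by [].
by rewrite e coefZ prodXw_coef0 mulr1.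
Qed.

(** * Truncations of mutually inverse series *)

Variables (A B : R).
Hypothesis (B0 : 0 < B).

(** The majorant A e^(BX) squares to A^2 e^(2BX), by the binomial theorem. *)
Lemma coefM_bound p q :
  (forall k, normc p`_k <= A * (B ^+ k / k`!%:R)) ->
  (forall k, normc q`_k <= A * (B ^+ k / k`!%:R)) ->
  forall k, normc (p * q)`_k <= A ^+ 2 * ((B *+ 2) ^+ k / k`!%:R).
Proof.
move=> hp hq k; rewrite coefM; apply: le_trans (normc_le_sum _ _ _) _.
rewrite mulr2n exprDn mulr_suml mulr_sumr; apply: ler_sum => j _.
have jk : (j <= k)%N by rewrite -ltnS.
rewrite Normc.normcM; apply: (@le_trans _ _ (A * (B ^+ j / j`!%:R) *
   (A * (B ^+ (k - j) / (k - j)`!%:R)))).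
  by rewrite ler_pM// normc_ge0.
rewrite le_eqVlt; apply/orP; left; apply/eqP.
have f0 m : m`!%:R != 0 :> R by rewrite pnatr_eq0 -lt0n fact_gt0.
have e := congr1 (fun m => m%:R : R) (bin_fact jk); rewrite /= !natrM in e.
rewrite -[_ *+ 'C(k, j)]mulr_natr -e.
by field; rewrite !f0 pnatr_eq0 -lt0n bin_gt0 jk.
Qed.

(* [p] and [q] are truncations of power series inverse to each other, so that
   [p q = 1 + O(X^N.+1)] with a tail too small to produce a zero of [p]. *)
Lemma trunc_root_bound N p q z :
  (forall k, normc p`_k <= A * (B ^+ k / k`!%:R)) ->
  (forall k, normc q`_k <= A * (B ^+ k / k`!%:R)) ->
  (size p <= N.+1)%N -> (size q <= N.+1)%N ->
  (forall k, (k <= N)%N -> (p * q)`_k = (k == 0%N)%:R) ->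
  A ^+ 2 < N%:R -> root p z -> N%:R <= B *+ 8 * expR 1 * normc z.
Proof.
move=> hp hq sp sq hpq AN /rootP pz; rewrite leNgt; apply/negP => hz.
have := coefM_bound hp hq => hb.
have N0 : 0 < N%:R :> R by apply: le_lt_trans AN; rewrite sqr_ge0.
have szpq : (size (p * q)%R <= N.+1 + N)%N.
  by have := size_polyMleq p q; lia.
(* At a root the product reads 0 = 1 + terms of degrees N+1 to 2N, so this tail has modulus 1. *)
have : (p * q).[z] = 0 by rewrite hornerM pz mul0r.
rewrite (horner_coef_wide z szpq) big_split_ord /= big_ord_recl /= hpq// expr0 mulr1.
rewrite big1 ?addr0; last by move=> i _; rewrite hpq ?mul0r// lift0.
move/eqP; rewrite addr_eq0 => /eqP /(congr1 (@Normc.normc R)).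
rewrite normc_nat normcN eqxx mulr1n => e1.
have : (1 : R) < 1; last by rewrite ltxx.
rewrite {1}e1; apply: le_lt_trans (normc_le_sum _ _ _) _.
(* By the choice of 8 e B, 2B|z| <= k/(4e); as k^k <= k! e^k, the term of degree k is at most A^2
   4^-k. The N terms add up to less than N^2 4^-N <= 1. *)
apply: (@le_lt_trans _ _ (\sum_(i < N) A ^+ 2 * 4^-1 ^+ N)).
  apply: ler_sum => i _; rewrite Normc.normcM normcX.
  set k := (N.+1 + i)%N.
  apply: (@le_trans _ _ (A ^+ 2 * 4^-1 ^+ k)); last first.
    rewrite ler_wpM2l ?sqr_ge0//; apply: ler_wiXn2l; rewrite ?invr_ge0//.
      by rewrite invf_le1// ler1n.
    by rewrite /k; lia.
  apply: le_trans (ler_wpM2r _ (hb k)) _; first by rewrite exprn_ge0// normc_ge0.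
  rewrite -mulrA ler_wpM2l ?sqr_ge0//.
  have f0 : 0 < k`!%:R :> R by rewrite ltr0n fact_gt0.
  have eN : B *+ 2 * normc z <= N%:R * (4^-1 * expR (- 1)).
    rewrite expRN mulrA ler_pdivlMr ?expR_gt0//; move: hz; lra.
  have kN : N%:R * (4^-1 * expR (-1)) <= k%:R * (4^-1 * expR (-1)) :> R.
    by rewrite ler_wpM2r ?ler_nat ?mulr_ge0 ?expR_ge0 ?invr_ge0// /k; lia.
  rewrite mulrAC -exprMn ler_pdivrMr//.
  apply: (@le_trans _ _ ((k%:R * (4^-1 * expR (- 1))) ^+ k)).
    rewrite lerXn2r ?nnegrE ?mulr_ge0 ?normc_ge0 ?invr_ge0 ?expR_ge0//.
      by rewrite mulrn_wge0// ltW.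
    exact: le_trans eN kN.
  rewrite !exprMn mulrCA ler_wpM2l ?exprn_ge0 ?invr_ge0//.
  rewrite -expRM_natl mulrN1 expRN ler_pdivrMr ?expR_gt0//.
  exact: expn_le_fact_expR.
rewrite sumr_const card_ord -[ltLHS]mulr_natr.
have N2 : N%:R <= 2 ^+ N :> R by rewrite -natrX ler_nat ltnW// ltn_expl.
have e4 : 4^-1 ^+ N * (2 ^+ N * 2 ^+ N) = 1 :> R.
  rewrite -!exprMn (_ : 4^-1 * (2 * 2) = 1) ?expr1n//.
  by rewrite -natrM mulVf// pnatr_eq0.
have p4 : 0 < 4^-1 ^+ N :> R by rewrite exprn_gt0// invr_gt0.
rewrite -[ltRHS]e4 mulrAC [ltLHS]mulrC ltr_pM2l//; apply: (@lt_le_trans _ _ (N%:R * N%:R)).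
  by rewrite mulrC ltr_pM2l.
by rewrite ler_pM.
Qed.

(** Coefficientwise this is F' F(0) = F'(0) F. The defect [E] satisfies |E| N <= M for all large N,
    with [M] independent of N. *)
Lemma unit_series_coef a b :
  (forall k, normc (a k) <= A * (B ^+ k / k`!%:R)) ->
  (forall k, normc (b k) <= A * (B ^+ k / k`!%:R)) ->
  (forall k, \sum_(j < k.+1) a j * b (k - j)%N = (k == 0%N)%:R) ->
  forall k, k.+1%:R * a k.+1 * a 0%N = a 1%N * a k.
Proof.
move=> ha hb hab k.
have a0 : a 0%N != 0.
  apply/eqP => a0; have := hab 0%N; rewrite big_ord_recl big_ord0 a0 mul0r addr0.
  by move/esym/eqP; rewrite oner_eq0.
pose K := B *+ 8 * expR 1.
have K0 : 0 <= K by rewrite mulr_ge0 ?expR_ge0// mulrn_wge0// ltW.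
have A0 : 0 <= A.
  by apply: le_trans (normc_ge0 (a 0%N)) _; have := ha 0%N; rewrite expr0 fact0 divr1 mulr1.
pose M := normc (a 0%N) ^+ 2 * (k%:R * K ^+ k.+1).
have M0 : 0 <= M by rewrite !mulr_ge0 ?exprn_ge0 ?normc_ge0.
set E := k.+1%:R * a k.+1 * a 0%N - a 1%N * a k.
suff EN N : (k < N)%N -> A ^+ 2 < N%:R -> normc E * N%:R <= M.
  apply/eqP; rewrite -subr_eq0 -/E; apply/eqP; apply: Normc.eq0_normc.
  apply/eqP; rewrite eq_le normc_ge0 andbT leNgt; apply/negP => e0.
  pose x := M / normc E + A ^+ 2 + k%:R.
  have x0 : 0 <= x by rewrite !addr_ge0 ?divr_ge0 ?sqr_ge0// ltW.
  have := archi_boundP x0; set N := Num.bound x => xN.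
  have m0 : 0 <= M / normc E by rewrite divr_ge0// ltW.
  have s0 : 0 <= A ^+ 2 by rewrite sqr_ge0.
  have := EN N; rewrite -(ltr_nat R) leNgt.
  have k0 : 0 <= k%:R :> R by [].
  rewrite /x in xN.
  have -> : k%:R < N%:R :> R by lra.
  have -> : A ^+ 2 < N%:R :> R by lra.
  have -> : M < normc E * N%:R by rewrite mulrC -ltr_pdivrMr//; lra.
  by move=> /(_ isT isT).
move=> kN AN.
have N0 : 0 < N%:R :> R by rewrite ltr0n (leq_ltn_trans _ kN).
pose p := \poly_(i < N.+1) a i; pose q := \poly_(i < N.+1) b i.
have trunc_bound (c : nat -> C) : (forall j, normc (c j) <= A * (B ^+ j / j`!%:R)) ->
    forall j, normc (\poly_(i < N.+1) c i)`_j <= A * (B ^+ j / j`!%:R).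
  move=> hc j; rewrite coef_poly; case: ifP => // _.
  by rewrite Normc.normc0 mulr_ge0// divr_ge0// exprn_ge0// ltW.
have pE j : (j <= N)%N -> p`_j = a j by move=> jN; rewrite coef_poly ltnS jN.
have hpq j : (j <= N)%N -> (p * q)`_j = (j == 0%N)%:R.
  move=> jN; rewrite coefM -hab; apply: eq_bigr => i _.
  have ij : (i <= j)%N by rewrite -ltnS.
  by rewrite pE ?(leq_trans ij)// coef_poly ltnS (leq_trans (leq_subr _ _)).
have [|s ps [ss hs]] := @poly_prodXw p; first by rewrite pE.
have sN : (size s <= N)%N by rewrite -ltnS (leq_trans ss)// size_poly.
(* The roots have modulus at least N/K, and k N^k d^(k+1) = k K^(k+1) / N yields [M]. *)
pose d := K / N%:R.
have d0 : 0 <= d by rewrite divr_ge0// ltW.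
have sd w : w \in s -> normc w <= d.
  move=> /hs[z pz ->].
  have := trunc_root_bound (trunc_bound _ ha) (trunc_bound _ hb)
    (size_poly _ _) (size_poly _ _) hpq AN pz; rewrite -/K => NK.
  have z0 : 0 < normc z.
    rewrite lt_neqAle normc_ge0 andbT; apply/eqP => z0.
    by move: NK; rewrite -z0 mulr0 leNgt N0.
  by rewrite Normc.normcV /d ler_pdivlMr// ler_pdivrMl// mulrC.
have := prodXw_deriv_bound k d0 sd; set D := (_ - _).
have -> : E = a 0%N ^+ 2 * D.
  have pj j : (j <= N)%N -> a j = a 0%N * (prodXw s)`_j.
    by move=> jN; rewrite -pE// ps coefZ pE.
  rewrite /E /D (pj k.+1)// (pj k) 1?ltnW// (pj 1%N) 1?(leq_ltn_trans _ kN)//.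
  ring.
move=> Db; rewrite Normc.normcM normcX /M -mulrA ler_wpM2l ?exprn_ge0 ?normc_ge0//.
rewrite -ler_pdivlMr//; apply: le_trans Db _.
rewrite -mulrA [leRHS]mulrAC -mulrA ler_wpM2l// /d.
apply: (@le_trans _ _ (N%:R ^+ k * (K / N%:R) ^+ k.+1)).
  by rewrite ler_wpM2r ?exprn_ge0// lerXn2r ?nnegrE// ler_nat.
rewrite !exprS exprMn exprVn le_eqVlt; apply/orP; left; apply/eqP.
by field; rewrite expf_neq0 gt_eqF.
Qed.

End UnitSeries.

(** * Moments of compactly supported distributions *)

Section Moments.
Variable R : realType.
Local Notation C := R[i].
Local Notation normc := (@Normc.normc R).
Implicit Types (phi psi : testfun R) (T u v : cdist R) (f g : {poly C}) (a b x : R).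

Lemma csmooth_horner f : csmooth (fun x : R => f.[x%:C%C]).
Proof.
elim/poly_ind: f => [|f c IH].
  rewrite (_ : (fun x => _) = fun=> 0); first exact: csmooth_cst.
  by apply/funext => x; rewrite horner0.
rewrite (_ : (fun x => _) =
    (fun x : R => f.[x%:C%C]) * (fun x : R => x%:C%C) + (fun=> c)).
  apply: csmoothD; last exact: csmooth_cst.
  apply: csmoothM => //; split; [exact: smooth_id|exact: smooth_cst].
by apply/funext => x; rewrite hornerMXaddC.
Qed.

(** Positive whatever the sign of [b]; a plateau of twice this radius is 1 on the interval of this
    radius. *)
Definition pcut_radius b : R := `|b| + 1.

Lemma pcut_radius_gt0 b : 0 < 2 * pcut_radius b.
Proof. by rewrite mulr_gt0// ltr_wpDl. Qed.

Lemma pcut_subproof b f : (fun x : R => (plateau 0 (2 * pcut_radius b) x)%:C%C *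
  f.[x%:C%C]) \in @test_function R.
Proof.
apply/test_functionP; split.
  apply: (@csmoothM _ (fun x => (plateau 0 (2 * pcut_radius b) x)%:C%C)
    (fun x => f.[x%:C%C])); last exact: csmooth_horner.
  split; [exact: smooth_plateau|exact: smooth_cst].
exists (2 * pcut_radius b) => x bx.
by rewrite plateau0 ?mul0r ?pcut_radius_gt0// subr0 ltW.
Qed.

Definition pcut b f : testfun R := TestFun (pcut_subproof b f).

Lemma pcut_val b f x :
  pcut b f x = (plateau 0 (2 * pcut_radius b) x)%:C%C * f.[x%:C%C].
Proof. by []. Qed.

Lemma pcutE b f x : `|x| <= pcut_radius b -> pcut b f x = f.[x%:C%C].
Proof.
move=> xb; rewrite /= plateau1 ?pcut_radius_gt0 ?mul1r// subr0.
by rewrite mulrAC divff ?mul1r.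
Qed.

Lemma pcut_linear b : linear (pcut b).
Proof.
move=> c f g; apply: testfun_ext => x; rewrite testfunDE testfunZE /=.
by rewrite hornerD hornerZ mulrDr mulrCA.
Qed.

Definition supp_radius T : R := projT1 (cid (cdist_supp T)).

Lemma supp_radiusP T phi : (forall x, `|x| <= supp_radius T -> phi x = 0) -> T phi = 0.
Proof. exact: (projT2 (cid (cdist_supp T))). Qed.

(* [T] extended to polynomials; by [pairE] the choice of cutoff is irrelevant. *)
Definition pairing T f : C := T (pcut (supp_radius T) f).

Lemma cdist_eq_on T a phi psi :
  (forall phi, (forall x, `|x| <= a -> phi x = 0) -> T phi = 0) ->
  (forall x, `|x| <= a -> phi x = psi x) -> T phi = T psi.
Proof.
move=> Ta e; apply/eqP; rewrite -subr_eq0 -cdistN -cdistD; apply/eqP/Ta => x xa.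
by rewrite testfunDE testfunNE e// subrr.
Qed.

(** Of the two support bounds [a] and [supp_radius T], the smaller one suffices to compare the test
    functions. *)
Lemma pairE T a f phi :
  (forall phi, (forall x, `|x| <= a -> phi x = 0) -> T phi = 0) ->
  (forall x, `|x| <= a -> phi x = f.[x%:C%C]) -> T phi = pairing T f.
Proof.
move=> Ta e; have cE x : `|x| <= supp_radius T ->
    pcut (supp_radius T) f x = f.[x%:C%C].
  move=> xT; apply: pcutE; rewrite /pcut_radius.
  by have := ler_norm (supp_radius T); lra.
have [aT|/ltW Ta'] := leP a (supp_radius T).
  apply: cdist_eq_on Ta _ => x xa; rewrite e// cE// (le_trans xa)//.
apply: cdist_eq_on (@supp_radiusP T) _ => x xa.
by rewrite e ?cE// (le_trans xa).
Qed.

Lemma pair_pcut T b f : supp_radius T <= b -> T (pcut b f) = pairing T f.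
Proof.
move=> Tb; apply: (pairE (@supp_radiusP T)) => x xT; apply: pcutE.
by rewrite /pcut_radius; have := ler_norm b; lra.
Qed.

Lemma pair_is_linear T : linear (pairing T).
Proof. by move=> c f g; rewrite /pairing pcut_linear cdist_linear. Qed.

HB.instance Definition _ T := GRing.isLinear.Build C {poly C} C *:%R (pairing T)
  (pair_is_linear T).

Lemma pairZ T (c : C) f : pairing T (c *: f) = c * pairing T f.
Proof. exact: linearZ. Qed.

Lemma pair_sum T (I : Type) (r : seq I) (P : pred I) (F : I -> {poly C}) :
  pairing T (\sum_(i <- r | P i) F i) = \sum_(i <- r | P i) pairing T (F i).
Proof. exact: linear_sum. Qed.

(** The cutoff in [pairing] varies with the distribution; a common larger one reduces the claim to
    pointwise operations. *)
Lemma pair_linearl f : scalar (fun T => pairing T f).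
Proof.
move=> c u v; pose b := Num.max (supp_radius (c *: u + v))
  (Num.max (supp_radius u) (supp_radius v)).
rewrite -!(@pair_pcut _ b)// ?le_max ?lexx ?orbT//.
Qed.

Lemma cdiracE a phi : cdirac a phi = phi a.
Proof. by []. Qed.

Lemma pair_dirac a f : pairing (cdirac a) f = f.[a%:C%C].
Proof.
rewrite -(@pair_pcut _ (Num.max `|a| (supp_radius (cdirac a)))) ?le_max ?lexx ?orbT//.
rewrite cdiracE pcutE// /pcut_radius.
set b := Num.max _ _; have ab : `|a| <= b by rewrite le_max lexx.
by have := ler_norm b; lra.
Qed.

Lemma pair_one f : pairing 1 f = f.[0].
Proof. exact: pair_dirac. Qed.

(** Expanding (x + y)^n shows that exponential generating series of moments multiply under
    convolution. *)
Lemma pair_mul u v n : pairing (u * v) 'X^n =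
  \sum_(k < n.+1) pairing u 'X^(n - k) * pairing v 'X^k *+ 'C(n, k).
Proof.
set su := supp_radius u; set sv := supp_radius v.
(* Large enough for the cutoff to be 1 at x + y when |x| <= [su] and |y| <= [sv]. *)
pose b := Num.max (supp_radius (u * v)) (`|su| + `|sv|).
rewrite -(@pair_pcut _ b) ?le_max ?lexx// cdist_mulE.
(* What remains of (x + y)^n, as a polynomial in x, after [v] acts in y. *)
pose g : {poly C} := \sum_(k < n.+1) (pairing v 'X^k *+ 'C(n, k)) *: 'X^(n - k).
rewrite (@pairE u su g _ (@supp_radiusP u)) => [|x xu].
  rewrite /g pair_sum; apply: eq_bigr => k _.
  by rewrite pairZ mulrnAl mulrC.
rewrite /= /conv_fun.
rewrite (@pairE v sv (((x%:C%C)%:P + 'X) ^+ n) _ (@supp_radiusP v)) => [|y yv].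
  rewrite exprDn pair_sum horner_sum; apply: eq_bigr => k _.
  rewrite -polyC_exp mul_polyC scalerMnl pairZ hornerZ hornerXn.
  by rewrite !mulrnAl mulrC.
rewrite -[LHS]/(pcut b 'X^n (x + y)) pcutE.
  by rewrite hornerXn horner_exp hornerD hornerC hornerX rmorphD.
rewrite /pcut_radius.
have : `|su| + `|sv| <= b by rewrite le_max lexx orbT.
have := ler_norm b; have := ler_norm su; have := ler_norm sv.
have := ler_normD x y; lra.
Qed.

(** The order estimate for [T] is applied to the cutoff times h^n, so |h| <= 1 is asked on the whole
    support of the cutoff. *)
Lemma pair_powers_bound T f (h : R -> R) : smooth h ->
  (forall x, f.[x%:C%C] = (h x)%:C%C) ->
  (forall x, `|x| <= 2 * pcut_radius (supp_radius T) -> `|h x| <= 1) ->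
  exists (N : nat) (c : R), 0 <= c /\
    forall n, normc (pairing T (f ^+ n)) <= c * n.+1%:R ^+ N.
Proof.
set rho := 2 * _ => sh fh h1.
have r0 : 0 < rho := pcut_radius_gt0 _.
have p0 x : rho < `|x| -> plateau 0 rho x = 0.
  by move=> rx; rewrite plateau0// subr0 ltW.
have [N [c [c0 hc]]] :=
  (distribution_continuousE T).1 (@cdist_continuous _ T) rho.
have /choice[d hd] : forall k, exists c : R, forall n x,
    `|(plateau 0 rho * h ^+ n)^`(k) x| <= c * n.+1%:R ^+ k.
  by move=> k; apply: (derive1n_powers_bound k sh h1 _ p0); exact: smooth_plateau.
have d0 k : 0 <= d k by have := hd k 0%N 0; rewrite expr1n mulr1; apply: le_trans.
pose D := \sum_(k < N.+1) d k.
have dD k : (k <= N)%N -> d k <= D.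
  move=> kN; rewrite /D (bigD1 (Ordinal (kN : (k < N.+1)%N)))//= lerDl.
  by apply: sumr_ge0.
have D0 : 0 <= D by apply: sumr_ge0.
exists N, (c * (N.+1%:R * D)); split; first by rewrite !mulr_ge0.
move=> n; apply: le_trans (hc _ _) _.
  by move=> x rx /=; rewrite p0// mul0r.
rewrite -!mulrA ler_wpM2l//; apply: seminorm_le => k kN; apply: supnorm_le => x.
set phi := pcut _ _.
have phiE y : phi y = ((plateau 0 rho * h ^+ n) y)%:C%C.
  rewrite pcut_val horner_exp fh -rmorphXn -rmorphM /=; congr (_%:C)%C.
  by rewrite [RHS]/(plateau 0 rho y * (h ^+ n) y) exprfctE.
apply: le_trans (normc_le_ReIm _) _; rewrite /cderive /=.
have -> : (@complex.Re R) \o phi = plateau 0 rho * h ^+ n.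
  by apply/funext => y; rewrite [LHS]/(complex.Re (phi y)) phiE.
have -> : (@complex.Im R) \o phi = fun=> 0.
  by apply/funext => y; rewrite [LHS]/(complex.Im (phi y)) phiE.
(* With the bound -1 every point lies outside the support, so all derivatives of 0 vanish. *)
rewrite (@derive1n_supp _ (fun=> 0) (-1))//; last by rewrite (lt_le_trans _ (normr_ge0 _))// ltrN10.
rewrite normr0 addr0; apply: le_trans (hd k n x) _.
by rewrite ler_pM ?exprn_ge0 ?dD// ler_weXn2l// ler1n.
Qed.

(** [pair_powers_bound] for X/rho, which is at most 1 in modulus on the support of the cutoff;
    (n+1)^N is absorbed by N! e^(n+1). *)
Lemma pair_moment_bound T : exists A B : R, [/\ 0 <= A, 0 < B &
  forall n, normc (pairing T 'X^n) <= A * B ^+ n].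
Proof.
pose rho := 2 * pcut_radius (supp_radius T).
have r0 : 0 < rho := pcut_radius_gt0 _.
have [||| N [c [c0 hc]]] := @pair_powers_bound T ((rho^-1)%:C%C *: 'X)
   ((fun=> rho^-1) * idfun).
- by apply: smoothM; [exact: smooth_cst|exact: smooth_id].
- by move=> x; rewrite hornerZ hornerX -rmorphM.
- move=> x xr; rewrite fctE normrM normfV (gtr0_norm r0) mulrC.
  by rewrite ler_pdivrMr// mul1r.
clearbody rho; exists (c * (N`!%:R * expR 1)), (rho * expR 1); split.
- by rewrite !mulr_ge0// expR_ge0.
- by rewrite mulr_gt0// expR_gt0.
move=> n; have -> : 'X^n = (rho ^+ n)%:C%C *: ((rho^-1)%:C%C *: 'X) ^+ n :> {poly C}.
  rewrite exprZn scalerA -rmorphXn -rmorphM /= -exprMn divff ?gt_eqF//.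
  by rewrite expr1n scale1r.
rewrite pairZ Normc.normcM.
have -> : normc (rho ^+ n)%:C%C = rho ^+ n.
  by rewrite /= expr0n addr0 sqrtr_sqr ger0_norm// exprn_ge0// ltW.
rewrite exprMn mulrCA ler_wpM2l ?exprn_ge0 ?(ltW r0)//.
apply: le_trans (hc n) _; rewrite -!mulrA ler_wpM2l//.
rewrite -expRM_natl mulr1 -expRD addrC natr1.
exact: expn_le_fact_expR.
Qed.

(** * Moments of invertible distributions *)

Lemma unit_moments u v : v * u = 1 ->
  forall k, pairing u 'X^(k.+1) * pairing u 1 = pairing u 'X * pairing u 'X^k.
Proof.
move=> vu1 k.
have [A1 [B1 [A10 B10 h1]]] := pair_moment_bound u.
have [A2 [B2 [A20 B20 h2]]] := pair_moment_bound v.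
pose A := A1 + A2; pose B := B1 + B2.
pose a (w : cdist R) j := pairing w 'X^j / j`!%:R.
have f0 j : j`!%:R != 0 :> C by rewrite pnatr_eq0 -lt0n fact_gt0.
have B0 : 0 < B by rewrite addr_gt0.
have ab w A' B' : 0 <= A' <= A -> 0 < B' <= B ->
    (forall n, normc (pairing w 'X^n) <= A' * B' ^+ n) ->
    forall j, normc (a w j) <= A * (B ^+ j / j`!%:R).
  move=> /andP[A'0 AA] /andP[B'0 BB] h j; rewrite Normc.normcM Normc.normcV normc_nat mulrA.
  rewrite ler_wpM2r ?invr_ge0//; apply: le_trans (h j) _.
  by rewrite ler_pM ?exprn_ge0 ?(ltW B'0)// lerXn2r ?nnegrE ?(ltW B'0) ?(ltW B0).
have hu : forall j, normc (a u j) <= A * (B ^+ j / j`!%:R).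
  by apply: (ab _ A1 B1) => //; rewrite ?A10 ?B10 /= ?lerDl// ltW.
have hv : forall j, normc (a v j) <= A * (B ^+ j / j`!%:R).
  by apply: (ab _ A2 B2) => //; rewrite ?A20 ?B20 /= ?lerDr// ltW.
have huv n : \sum_(j < n.+1) a u j * a v (n - j)%N = (n == 0%N)%:R.
  have := pair_mul v u n; rewrite vu1 pair_one hornerXn expr0n => e.
  have -> : (n == 0%N)%:R = (n == 0%N)%:R / n`!%:R :> C.
    by case: n {e} => [|n]; rewrite ?fact0 ?divr1// mul0r.
  (* Division by n! turns the binomial convolution of moments into a Cauchy product. *)
  rewrite e mulr_suml; apply: eq_bigr => j _; rewrite /a.
  have jn : (j <= n)%N by rewrite -ltnS.
  have := congr1 (fun m => m%:R : C) (bin_fact jn); rewrite /= !natrM => bf.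
  rewrite -[_ *+ 'C(n, j)]mulr_natr -bf.
  by field; rewrite !f0 pnatr_eq0 -lt0n bin_gt0 jn.
have := unit_series_coef B0 hu hv huv k; rewrite /a expr0 expr1 fact0 !divr1.
rewrite factS natrM => e.
have k0 : k.+1%:R != 0 :> C by rewrite pnatr_eq0.
transitivity (k.+1%:R * (pairing u 'X^(k.+1) / (k.+1%:R * k`!%:R)) * pairing u 1 * k`!%:R).
  by field; rewrite f0 nat1r k0.
by rewrite e -mulrA divfK.
Qed.

(** The zeroth moments of [u] and [v] have product 1, and [unit_moments] makes the moments of [u]
    geometric, with ratio the first over the zeroth. *)
Lemma unit_pair_horner u v : v * u = 1 ->
  pairing u 1 != 0 /\ exists alpha, forall f, pairing u f = pairing u 1 * f.[alpha].
Proof.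
move=> vu1; have m0 : pairing u 1 != 0.
  have := pair_mul v u 0; rewrite vu1 pair_one big_ord_recl big_ord0 /=.
  rewrite subnn expr0 hornerC addr0 bin0 mulr1n => e; apply/eqP => e0.
  by move/eqP: e; rewrite e0 mulr0 oner_eq0.
split=> //; exists (pairing u 'X / pairing u 1) => f; set al := _ / _.
have mX k : pairing u 'X^k = pairing u 1 * al ^+ k.
  elim: k => [|k IH]; first by rewrite !expr0 mulr1.
  apply: (mulIf m0); rewrite (unit_moments vu1) IH exprS /al; by field.
rewrite -[f in LHS]coefK poly_def pair_sum horner_coef mulr_sumr.
by apply: eq_bigr => i _; rewrite pairZ mX mulrCA.
Qed.

(* If [alpha] had imaginary part [t != 0], the powers of the polynomial
   [1 - (X - Re alpha)^2 / M], which takes values in [-1, 1] on the support of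
   [u] and the value [1 + t^2 / M] at [alpha], would contradict the continuity
   of [u]. *)
Lemma unit_pair_real u alpha : pairing u 1 != 0 ->
  (forall f, pairing u f = pairing u 1 * f.[alpha]) -> complex.Im alpha = 0.
Proof.
case: alpha => s t m0 hu /=; apply/eqP/negPn/negP => t0.
pose rho := 2 * pcut_radius (supp_radius u).
(* Makes (x - s)^2 / M at most 1 for |x| <= [rho], hence on the support of the cutoff. *)
pose M := (rho + `|s|) ^+ 2.
have r0 : 0 < rho := pcut_radius_gt0 _.
have M0 : 0 < M by rewrite exprn_gt0// ltr_wpDr.
pose f : {poly C} := 1 - (M^-1)%:C%C *: ('X - (s%:C%C)%:P) ^+ 2.
pose h : R -> R := (fun=> 1) + (fun=> - M^-1) * (idfun + (fun=> - s)) ^+ 2.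
have hE x : h x = 1 - M^-1 * (x - s) ^+ 2.
  by rewrite [LHS]/(1 + - M^-1 * ((idfun + (fun=> - s)) ^+ 2) x) exprfctE mulNr.
have [||| N [c [c0 hc]]] := @pair_powers_bound u f h.
- apply: smoothD; first exact: smooth_cst.
  apply: smoothM; first exact: smooth_cst.
  by apply: smoothX; apply: smoothD; [exact: smooth_id|exact: smooth_cst].
- move=> x; rewrite hE /f hornerD hornerN hornerZ horner_exp hornerXsubC hornerC.
  by rewrite rmorphB rmorphM rmorphXn rmorphB rmorph1.
- move=> x; rewrite -/rho => xr; rewrite hE.
  have xs : (x - s) ^+ 2 <= M.
    rewrite -[leLHS]real_normK ?num_real// lerXn2r ?nnegrE ?addr_ge0 ?(ltW r0)//.
    by apply: le_trans (ler_normB _ _) _; rewrite lerD2r.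
  have y1 : M^-1 * (x - s) ^+ 2 <= 1 by rewrite ler_pdivrMl// mulr1.
  have y0 : 0 <= M^-1 * (x - s) ^+ 2 by rewrite mulr_ge0 ?invr_ge0 ?sqr_ge0 ?(ltW M0).
  by rewrite ler_norml; lra.
have fE : f.[(s +i* t)%C] = (1 + t ^+ 2 / M)%:C%C.
  rewrite /f hornerD hornerN hornerZ horner_exp hornerXsubC hornerC.
  apply/eqP; rewrite expr2 eq_complex /=; apply/andP; split; apply/eqP; ring.
have m0' : 0 < normc (pairing u 1).
  rewrite lt_neqAle normc_ge0 andbT; apply/eqP => /esym/Normc.eq0_normc e.
  by move/eqP: m0.
have t2 : 0 < t ^+ 2 / M by rewrite divr_gt0// exprn_even_gt0.
apply: (@exponential_not_polynomial R (normc (pairing u 1)) (1 + t ^+ 2 / M) c N) => //.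
  by rewrite ltrDl.
move=> n; apply: le_trans (hc n); rewrite (hu (f ^+ n)) horner_exp fE Normc.normcM normcX.
have -> : normc (1 + t ^+ 2 / M)%:C%C = 1 + t ^+ 2 / M; last by [].
by rewrite /= expr0n addr0 sqrtr_sqr ger0_norm// addr_ge0// ltW.
Qed.

End Moments.

(* The complex algebra E'(R) = cdist R over R[i], R any model of the reals. *)
Theorem proposition4p4 (R : realType) :
  ~ @GKZ_algebra (R[i] : fieldType) (cdist R : algType R[i]).
Proof.
(* Its value at 0 is 1 and its only root is i, which is not real. *)
pose g : {poly R[i]} := 1 + 'i%C *: 'X.
pose isL := GRing.isLinear.Build R[i] (cdist R) R[i] *%R (fun T => pairing T g)
  (pair_linearl g).
pose Lambda : {scalar cdist R} := HB.pack (fun T => pairing T g) isL.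
have LE T : Lambda T = pairing T g by [].
move=> gkz; have H S T : pairing (S * T) g = pairing S g * pairing T g.
  rewrite -!LE; apply: gkz => [u [v [_ vu1]]|]; rewrite LE; last first.
    by rewrite pair_one /g hornerD hornerZ hornerX hornerC mulr0 addr0.
  have [m0 [al hal]] := unit_pair_horner vu1.
  have := unit_pair_real m0 hal.
  case: al hal => s t hal /= t0; rewrite t0 in hal.
  rewrite hal; apply/eqP; rewrite mulf_neq0// /g hornerD hornerZ hornerX hornerC.
  by rewrite eq_complex /= !mul0r !mulr0 subr0 addr0 oner_eq0.
have gE T : pairing T g = 'i%C * pairing T 'X^1 + pairing T 'X^0.
  by rewrite /g addrC; exact: pair_is_linear.
(* Multiplicativity would give g(2) = g(1)^2, that is 1 + 2i = (1 + i)^2 = 2i; the real parts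
   differ. *)
have := H (cdirac 1) (cdirac 1); rewrite !gE !pair_mul.
rewrite !big_ord_recl !big_ord0 !pair_dirac !hornerXn /= !expr1n.
by move=> /eqP; rewrite eq_complex /= => /andP[/eqP + _]; lra.
Qed.
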